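(* Every pretzel knot $K$ has nontrivial Jones polynomial, i.e. $V_K(t)\neq 1$.
   Context: For nonzero integers $c_1,\dots,c_n$, the pretzel link $P(c_1,\dots,c_n)$ is the link with the standard diagram consisting of $n$ vertically twisted 2-tangles placed side by side, the $i$-th having $|c_i|$ half twists; adjacent tangles are joined at the top and at the bottom by arcs, cyclically (the last is joined to the first). If $c_i>0$ the twists are positive (the overcrossing strand has positive slope in the plane), and if $c_i<0$ they are negative (the overcrossing strand has negative slope). A pretzel knot is a pretzel link with one component. $V_K(t)$ is the Jones polynomial of $K$, normalized to equal $1$ for the unknot.
   Formalization: The formal theorem assumes in addition that the pretzel knot K is not the unknot, since pretzel diagrams of the unknot such as P(1) or P(1,-2) have V_K(t) = 1. *)

(* Defs.v *)
From HB Require Import structures.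
From mathcomp Require Import all_boot all_order all_algebra.
From Stdlib Require Import Relations.Relation_Operators.

Set Implicit Arguments.
Unset Strict Implicit.
Unset Printing Implicit Defensive.

Import Order.TTheory GRing.Theory Num.Theory.

(* A link diagram in Morse position, cut by horizontal lines into slices that  *)
(* contain one local maximum (Cap), one local minimum (Cup) or one crossing.   *)
(* In Cross e, e = true iff the overcrossing strand has positive slope.        *)
(* The slice (p, i) has i vertical strands to the left of p, and the list is   *)
(* read from top to bottom.                                                    *)
Inductive piece := Cap | Cup | Cross of bool.

Definition diagram := seq (piece * nat).

Definition ins (p : piece) : nat := if p is Cap then 0 else 2.
Definition outs (p : piece) : nat := if p is Cup then 0 else 2.

(* w can follow k strands, and no strand is left at the bottom of w.           *)
Fixpoint closed_diagram_from (k : nat) (w : diagram) : bool :=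
  match w with
  | [::] => k == 0
  | (p, i) :: w' => (i + ins p <= k) && closed_diagram_from (k - ins p + outs p) w'
  end.

Definition closed_diagram (w : diagram) : bool := closed_diagram_from 0 w.

Section Strands.
Variable T : Type.
Implicit Types (x y : T) (l : seq T) (i : nat).

Definition insert2 i x y l : seq T := take i l ++ [:: x, y & drop i l].
Definition delete2 i l : seq T := take i l ++ drop i.+2 l.
Definition swap2 x0 i l : seq T :=
  take i l ++ [:: nth x0 l i.+1, nth x0 l i & drop i.+2 l].

End Strands.

(* Reading w downwards, l lists the names of the arcs the current strands      *)
(* belong to. A Cup joining two strands of the same arc completes a component, *)
(* otherwise it merges two arcs.                                               *)
Fixpoint components_from (fresh : nat) (l : seq nat) (w : diagram) : nat :=
  match w with
  | [::] => 0
  | (Cap, i) :: w' => components_from fresh.+1 (insert2 i fresh fresh l) w'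
  | (Cup, i) :: w' =>
      let x := nth 0 l i in
      let y := nth 0 l i.+1 in
      (x == y) + components_from fresh
                   [seq if z == y then x else z | z <- delete2 i l] w'
  | (Cross _, i) :: w' => components_from fresh (swap2 0 i l) w'
  end.

Definition components (w : diagram) : nat := components_from 0 [::] w.

Definition is_knot (w : diagram) : bool := closed_diagram w && (components w == 1).

(* Reidemeister moves and planar isotopies of diagrams in Morse position       *)
(* (the unoriented, unframed Freyd-Yetter-Turaev relations on tangle words).   *)
Inductive local_move : diagram -> diagram -> Prop :=
  | far_commute p q i d :
      local_move [:: (p, i); (q, i + outs p + d)]
                 [:: (q, i + ins p + d); (p, i)]
  | zigzag_left i : local_move [:: (Cap, i.+1); (Cup, i)] [::]
  | zigzag_right i : local_move [:: (Cap, i); (Cup, i.+1)] [::]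
  | slide_cap e i :
      local_move [:: (Cap, i); (Cross e, i.+1)]
                 [:: (Cap, i.+1); (Cross (~~ e), i)]
  | slide_cup e i :
      local_move [:: (Cross e, i.+1); (Cup, i)]
                 [:: (Cross (~~ e), i); (Cup, i.+1)]
  | reidemeister1_cap e i : local_move [:: (Cap, i); (Cross e, i)] [:: (Cap, i)]
  | reidemeister1_cup e i : local_move [:: (Cross e, i); (Cup, i)] [:: (Cup, i)]
  | reidemeister2 e i : local_move [:: (Cross e, i); (Cross (~~ e), i)] [::]
  | reidemeister3 e i :
      local_move [:: (Cross e, i); (Cross e, i.+1); (Cross e, i)]
                 [:: (Cross e, i.+1); (Cross e, i); (Cross e, i.+1)].

Inductive move : diagram -> diagram -> Prop :=
  Move u v w w' : local_move w w' ->
    closed_diagram (u ++ w ++ v) -> closed_diagram (u ++ w' ++ v) ->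
    move (u ++ w ++ v) (u ++ w' ++ v).

Definition isotopic : diagram -> diagram -> Prop :=
  clos_refl_sym_trans diagram move.

Definition circle : diagram := [:: (Cap, 0); (Cup, 0)].

Definition unknotted (w : diagram) : Prop := isotopic w circle.

(* An orientation is given by the directions of the left legs of the Caps, in  *)
(* the order of w (true: downwards); d lists the directions of the current     *)
(* strands.                                                                    *)
Fixpoint orientation_from (d : seq bool) (w : diagram) (o : seq bool) : bool :=
  match w with
  | [::] => nilp o
  | (Cap, i) :: w' =>
      if o is b :: o' then orientation_from (insert2 i b (~~ b) d) w' o'
      else false
  | (Cup, i) :: w' =>
      (nth true d i != nth true d i.+1) && orientation_from (delete2 i d) w' o
  | (Cross _, i) :: w' => orientation_from (swap2 true i d) w' o
  end.

Definition orientation (w : diagram) (o : seq bool) : bool :=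
  orientation_from [::] w o.

Local Open Scope ring_scope.

Definition sgn (e : bool) : int := if e then 1 else -1.

(* Cross true is a positive crossing iff its two strands are both oriented     *)
(* upwards or both downwards.                                                  *)
Fixpoint writhe_from (d : seq bool) (w : diagram) (o : seq bool) : int :=
  match w with
  | [::] => 0
  | (Cap, i) :: w' =>
      let b := head true o in
      writhe_from (insert2 i b (~~ b) d) w' (behead o)
  | (Cup, i) :: w' => writhe_from (delete2 i d) w' o
  | (Cross e, i) :: w' =>
      sgn (e == (nth true d i == nth true d i.+1))
        + writhe_from (swap2 true i d) w' o
  end.

Definition writhe (w : diagram) (o : seq bool) : int := writhe_from [::] w o.

(* The Kauffman states of w, each with its number of A-smoothings minus its    *)
(* number of B-smoothings. The A-smoothing of Cross true is the vertical one.  *)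
Fixpoint states (w : diagram) : seq (int * diagram) :=
  match w with
  | [::] => [:: (0, [::])]
  | (Cross e, i) :: w' =>
      [seq (sgn e + s.1, s.2) | s <- states w']
      ++ [seq (- sgn e + s.1, [:: (Cup, i), (Cap, i) & s.2]) | s <- states w']
  | x :: w' => [seq (s.1, x :: s.2) | s <- states w']
  end.

(* Laurent polynomials in t^(1/4) are taken in the field Q(t^(1/4)), with t4   *)
(* for t^(1/4); Kauffman's variable is A = t^(-1/4).                           *)
Definition t4 : {fraction {poly int}} := tofrac 'X.
Definition varA : {fraction {poly int}} := t4^-1.
Definition delta : {fraction {poly int}} := - varA ^+ 2 - varA ^- 2.

(* Normalized so that the circle has bracket 1.                                *)
Definition bracket (w : diagram) : {fraction {poly int}} :=
  \sum_(s <- states w) varA ^ s.1 * delta ^+ (components s.2).-1.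

Definition jones (w : diagram) (o : seq bool) : {fraction {poly int}} :=
  (- varA ^+ 3) ^ (- writhe w o) * bracket w.

Definition twists (x : int) (i : nat) : diagram :=
  nseq `|x|%N (Cross (0 < x), i.*2).

(* Inserting n - 1 Caps at position 1 inside the outer Cap puts an arc between *)
(* strands 2i+1 and 2i+2 (right end of column i, left end of column i+1) for   *)
(* each i < n - 1; the outer Cap joins the first strand to the last one.       *)
Definition pretzel (c : seq int) : diagram :=
  (Cap, 0%N) :: nseq (size c).-1 (Cap, 1%N)
    ++ flatten [seq twists c`_i i | i <- iota 0 (size c)]
    ++ rcons (nseq (size c).-1 (Cup, 1%N)) (Cup, 0%N).

(* Main.v *)
Require Import Defs.
From mathcomp Require Import all_boot all_order all_algebra.
From mathcomp Require Import zify ring.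
From Stdlib Require Import Relations.Relation_Operators.

(** The Jones polynomial of a pretzel link is computed in closed form, and the
    few pretzel links for which it can be 1 are unknotted by explicit moves.

    The bracket.  The Kauffman bracket writes a column of c half twists as a
    combination of a column without crossings and of the flat tangle made of a
    Cup above a Cap (state_sum_twist).  Two adjacent columns without crossings,
    or flat, fuse into a single one (fuse), so that fusing all columns gives a
    product formula (pretzel_state_sum).  With u = - t, q = 1 - u - 1/u and d
    the value of a circle, it says that, up to a power of A,
       d^(n+1) <P(c)> = prod (q + u^c_i) + q prod (u^c_i - 1).
    Since d is a unit times 1 - u, a Jones polynomial equal to 1 makes the
    right-hand side equal to a power of t times (1 - u)^(n+1), up to sign.

    The equation.  A column with one crossing contributes a factor 1 - u, up to
    a signed power of u, to both products.  Hence only the excess e of entries 1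
    over entries -1 and the long columns matter, those with at least two
    crossings.  If a of them are positive, b negative and N = a + b, clearing
    denominators leaves
       u^(1 - e - a) P - Q = +- u^j (1 - u)^(N+1)
    with explicit polynomials P and Q (trivial_eq), and the mirror image gives
    the same equation with e and a replaced by - e and b.  On the right-hand
    side the two lowest coefficients have quotient - (N + 1); comparing them
    with those of P and Q shows that for N >= 2 both exponents 1 - e - a and
    1 + e - b are 0 or -1 (second_coefficient).  As they add up to 2 - N, there
    are at most four long columns.  Dividing by (1 - u)^N and differentiating at
    u = 1 gives the condition that the determinant of the link is 1.  Together
    with the values of the equation at u = 2 and u = -1 it leaves, up to mirror
    images, only (trivial_eq_cases):
       - no long column and e = 1;
       - one long column and e = 0, or a long column 2 and e = -1;
       - two long columns x, y with x + y = 1 and e = 0, or {2, 3} and e = -1.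

    The diagrams.  A column with one crossing flypes past any other column
    (flype), columns 1 and -1 cancel, and columns 2 and -1 merge into one column
    -2.  This reduces each exceptional pretzel link to a single column, which is
    undone by Reidemeister 1 moves, or to two columns x and y with x + y = 1 or
    -1: the second one slides around the two nested maxima onto the first, and
    their crossings cancel but for one kink (unknotted_one, unknotted_two). *)

Set Implicit Arguments.
Unset Strict Implicit.
Unset Printing Implicit Defensive.

(** * Tangle words up to isotopy *)

Arguments ins : simpl nomatch.
Arguments outs : simpl nomatch.

Fixpoint fits (k : nat) (w : diagram) : bool :=
  if w is (p, i) :: w' then (i + ins p <= k) && fits (k - ins p + outs p) w'
  else true.

Fixpoint width (k : nat) (w : diagram) : nat :=
  if w is (p, i) :: w' then width (k - ins p + outs p) w' else k.

Definition shift (a : nat) (w : diagram) : diagram :=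
  [seq (x.1, a + x.2) | x <- w].

Lemma closed_fits k w :
  closed_diagram_from k w = fits k w && (width k w == 0).
Proof. by elim: w k => //= -[p i] w IH k; rewrite IH andbA. Qed.

Lemma fits_cat k u v : fits k (u ++ v) = fits k u && fits (width k u) v.
Proof. by elim: u k => //= -[p i] u IH k; rewrite IH andbA. Qed.

Lemma width_cat k u v : width k (u ++ v) = width (width k u) v.
Proof. by elim: u k => //= -[p i] u IH k. Qed.

Lemma shift_cat a u v : shift a (u ++ v) = shift a u ++ shift a v.
Proof. exact: map_cat. Qed.

Lemma shift0 w : shift 0 w = w.
Proof. by rewrite /shift; elim: w => //= -[p i] w ->. Qed.

Lemma shiftD a b w : shift a (shift b w) = shift (a + b) w.
Proof. by rewrite /shift -map_comp; apply: eq_map => -[p i] /=; rewrite addnA. Qed.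

Lemma fits_shift a b k w : fits k w ->
  fits (a + k + b) (shift a w) /\ width (a + k + b) (shift a w) = a + width k w + b.
Proof.
elim: w k => //= -[p i] w IH k /andP[ik fw].
have -> : a + k + b - ins p + outs p = a + (k - ins p + outs p) + b by lia.
have [-> ->] := IH _ fw; rewrite andbT; split=> //=; lia.
Qed.

(** Isotopies are only defined for closed diagrams, so two words below k strands are
    compared in all closed diagrams that contain them.  Quantifying over the shift
    a as well makes the relation a congruence for horizontal juxtaposition, not
    only for vertical composition. *)
Definition tangle_eq (k : nat) (w w' : diagram) : Prop :=
  [/\ fits k w, fits k w', width k w = width k w' &
      forall a u v, a + k <= width 0 u ->
        closed_diagram (u ++ shift a w ++ v) ->
        isotopic (u ++ shift a w ++ v) (u ++ shift a w' ++ v)].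

(** Both directions of an isotopy must stay among closed diagrams; this is what makes
    tangle_eq symmetric. *)
Lemma closed_subst a k w w' u v :
  fits k w -> fits k w' -> width k w = width k w' -> a + k <= width 0 u ->
  closed_diagram (u ++ shift a w ++ v) -> closed_diagram (u ++ shift a w' ++ v).
Proof.
move=> fw fw' eqw au; rewrite /closed_diagram !closed_fits !fits_cat !width_cat.
have -> : width 0 u = a + k + (width 0 u - (a + k)) by lia.
have [-> ->] := fits_shift a (width 0 u - (a + k)) fw.
by have [-> ->] := fits_shift a (width 0 u - (a + k)) fw'; rewrite eqw.
Qed.

Lemma tangle_eq_refl k w : fits k w -> tangle_eq k w w.
Proof. by move=> fw; split=> // a u v _ _; apply: rst_refl. Qed.

Lemma tangle_eq_sym k w w' : tangle_eq k w w' -> tangle_eq k w' w.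
Proof.
move=> [fw fw' ew H]; split=> // a u v au cl; apply: rst_sym; apply: H => //.
exact: closed_subst fw' fw (esym ew) au cl.
Qed.

Lemma tangle_eq_trans k w2 w1 w3 : tangle_eq k w1 w2 -> tangle_eq k w2 w3 -> tangle_eq k w1 w3.
Proof.
move=> [f1 f2 e12 H1] [_ f3 e23 H2]; split=> //; first by rewrite e12.
move=> a u v au cl; apply: rst_trans (H1 _ _ _ au cl) _.
by apply: H2 => //; exact: closed_subst f1 f2 e12 au cl.
Qed.

Lemma tangle_eq_ctx k a b w w' : fits k a -> tangle_eq (width k a) w w' ->
  fits (width (width k a) w) b -> tangle_eq k (a ++ w ++ b) (a ++ w' ++ b).
Proof.
move=> fa [fw fw' ew H] fb; split.
- by rewrite !fits_cat fa fw.
- by rewrite !fits_cat fa fw' -ew.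
- by rewrite !width_cat ew.
move=> c u v cu cl; move: cl; rewrite !shift_cat -!catA !(catA u) => cl.
apply: H cl; rewrite width_cat.
have -> : width 0 u = c + k + (width 0 u - (c + k)) by lia.
have [_ ->] := fits_shift c (width 0 u - (c + k)) fa; lia.
Qed.

Lemma tangle_eq_catl k a w w' : fits k a -> tangle_eq (width k a) w w' ->
  tangle_eq k (a ++ w) (a ++ w').
Proof.
by move=> fa E; have := @tangle_eq_ctx k a [::] w w' fa E isT; rewrite !cats0.
Qed.

Lemma tangle_eq_catr k b w w' : tangle_eq k w w' -> fits (width k w) b ->
  tangle_eq k (w ++ b) (w' ++ b).
Proof. by move=> E fb; apply: (@tangle_eq_ctx k [::]). Qed.

Lemma tangle_eq_shift a b k w w' : tangle_eq k w w' ->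
  tangle_eq (a + k + b) (shift a w) (shift a w').
Proof.
move=> [fw fw' ew H]; have [f1 e1] := fits_shift a b fw.
have [f2 e2] := fits_shift a b fw'; split=> //; first by rewrite e1 e2 ew.
by move=> c u v cu; rewrite !shiftD => cl; apply: H => //; lia.
Qed.

Lemma tangle_eq_isotopic w w' : closed_diagram w -> tangle_eq 0 w w' -> isotopic w w'.
Proof.
move=> cl [_ _ _ H]; move: (H 0 [::] [::] isT); rewrite !shift0 !cats0.
exact.
Qed.

Lemma local_move_shift a w w' :
  local_move w w' -> local_move (shift a w) (shift a w').
Proof.
case=> [p q i d|i|i|e i|e i|e i|e i|e i|e i]; rewrite /shift /= ?addnS.
- by rewrite !addnA; constructor.
all: by constructor.
Qed.

Lemma local_move_width k w w' : local_move w w' -> fits k w -> fits k w' ->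
  width k w = width k w'.
Proof. case=> [p q i d|i|i|e i|e i|e i|e i|e i|e i] /=; lia. Qed.

Lemma tangle_eq_move k w w' : local_move w w' -> fits k w -> fits k w' -> tangle_eq k w w'.
Proof.
move=> mv fw fw'; have ew := local_move_width mv fw fw'.
split=> // a u v au cl; apply: rst_step; apply: Move => //.
- exact: local_move_shift.
- exact: closed_subst fw fw' ew au cl.
Qed.

(** * Sliding tangles past each other *)

Lemma tangle_eq_far_piece k m p i w : fits k w -> i + ins p <= m ->
  tangle_eq (k + m) ((p, k + i) :: w) (rcons w (p, width k w + i)).
Proof.
elim: w k => [|[q j] w IH] k /=.
  by move=> _ im; apply: tangle_eq_refl; rewrite /=; lia.
move=> /andP[jk fw] im.
have fw2 := fits_shift 0 m fw; rewrite !add0n shift0 in fw2.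
have [fwm ewm] := fw2.
have eqk : k + m - ins q + outs q = (k - ins q + outs q) + m by lia.
apply: (@tangle_eq_trans _ ([:: (q, j)] ++ ((p, (k - ins q + outs q) + i) :: w))); last first.
  apply: (@tangle_eq_catl _ [:: (q, j)]); first by rewrite /=; lia.
  by rewrite /= eqk; apply: IH.
apply: (@tangle_eq_catr _ w [:: (p, k + i); (q, j)] [:: (q, j); (p, (k - ins q + outs q) + i)]).
  apply: tangle_eq_sym; have := far_commute q p j (k - ins q - j + i).
  have -> : j + outs q + (k - ins q - j + i) = k - ins q + outs q + i by lia.
  have -> : j + ins q + (k - ins q - j + i) = k + i by lia.
  by move=> mv'; apply: tangle_eq_move mv' _ _ => /=; lia.
have [fwm' _] := fits_shift 0 (m - ins p + outs p) fw.
rewrite /= ; move: fwm'; rewrite add0n shift0; congr fits; lia.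
Qed.

(** Two tangles that stand side by side can exchange their heights, because every
    piece of one commutes with every piece of the other. *)
Lemma tangle_eq_interchange k m u w : fits k u -> fits m w ->
  tangle_eq (k + m) (u ++ shift (width k u) w) (shift k w ++ u).
Proof.
elim: w m => [|[p i] w IH] m fu /= ; first by rewrite cats0 => _; apply: tangle_eq_refl; have [] := fits_shift 0 m fu; rewrite add0n shift0.
move=> /andP[im fw]; have [fum eum] := fits_shift 0 m fu.
rewrite !add0n shift0 in fum eum.
have E1 := tangle_eq_sym (tangle_eq_far_piece fu im).
have E2 := IH _ fu fw.
have eqm : k + m - ins p + outs p = k + (m - ins p + outs p) by lia.
rewrite -cat_rcons.
apply: (@tangle_eq_trans _ (((p, k + i) :: u) ++ shift (width k u) w)).
  apply: tangle_eq_catr E1 _.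
  have [fwu _] := fits_shift (width k u) 0 fw.
  rewrite -cats1 width_cat eum /=; move: fwu; rewrite addn0; congr fits; lia.
apply: (@tangle_eq_catl _ [:: (p, k + i)]) => /=; first by lia.
by rewrite eqm.
Qed.

(** * Twist regions of two strands *)

(** The signs are listed one by one, and may differ, so that a twist region can be
    reversed and can absorb a further crossing. *)
Definition twist (i : nat) (X : seq bool) : diagram := [seq (Cross s, i) | s <- X].

Lemma fits_twist k i X : i.+2 <= k -> fits k (twist i X) /\ width k (twist i X) = k.
Proof.
move=> ik; elim: X => //= s X [IH1 IH2].
have -> : k - 2 + 2 = k by lia.
by rewrite IH1 IH2; split=> //; lia.
Qed.

Lemma shift_twist a i X : shift a (twist i X) = twist (a + i) X.
Proof. by rewrite /shift /twist -map_comp. Qed.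

Lemma twist_far_right p i d X k : i + outs p + d + 2 <= k - ins p + outs p -> i + ins p <= k ->
  tangle_eq k ((p, i) :: twist (i + outs p + d) X) (rcons (twist (i + ins p + d) X) (p, i)).
Proof.
move=> dk ik; elim: X => [|s X IH] /=; first by apply: tangle_eq_refl; rewrite /= ik.
apply: (@tangle_eq_trans _ ([:: (Cross s, i + ins p + d)] ++ (p, i) :: twist (i + outs p + d) X)).
  apply: (@tangle_eq_catr _ (twist (i + outs p + d) X) [:: _; _] [:: _; _]).
    by apply: tangle_eq_move (far_commute _ _ _ _) _ _ => /=; lia.
  have -> : width k [:: (p, i); (Cross s, i + outs p + d)] = k - ins p + outs p by move=> /=; lia.
  by have [] := @fits_twist (k - ins p + outs p) (i + outs p + d) X; first lia.
apply: (@tangle_eq_catl _ [:: _]) => /=; first by lia.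
by have -> : k - 2 + 2 = k by lia.
Qed.

Lemma twist_far_left p i j X k : j + 2 <= i -> i + ins p <= k ->
  tangle_eq k ((p, i) :: twist j X) (rcons (twist j X) (p, i)).
Proof.
move=> ji ik; elim: X => [|s X IH] /=; first by apply: tangle_eq_refl; rewrite /= ik.
apply: (@tangle_eq_trans _ ([:: (Cross s, j)] ++ (p, i) :: twist j X)).
  apply: (@tangle_eq_catr _ (twist j X) [:: _; _] [:: _; _]).
    apply: tangle_eq_sym; have := far_commute (Cross s) p j (i - j - 2).
    have -> : j + outs (Cross s) + (i - j - 2) = i by rewrite /=; lia.
    by move=> mv; apply: tangle_eq_move mv _ _ => /=; lia.
  have -> : width k [:: (p, i); (Cross s, j)] = k - ins p + outs p by move=> /=; lia.
  by have [] := @fits_twist (k - ins p + outs p) j X; first lia.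
apply: (@tangle_eq_catl _ [:: _]) => /=; first by lia.
by have -> : k - 2 + 2 = k by lia.
Qed.

(** For s = e this is the third Reidemeister move.  For s = ~~ e, in braid notation,
    a b a^-1 = b^-1 (b a b) a^-1 = b^-1 (a b a) a^-1 = b^-1 a b. *)
Lemma slide_crossing e s : tangle_eq 3
  [:: (Cross e, 0); (Cross e, 1); (Cross s, 0)]
  [:: (Cross s, 1); (Cross e, 0); (Cross e, 1)].
Proof.
have [->|->] : s = e \/ s = ~~ e by case: s e => [] []; auto.
  by apply: tangle_eq_move; first exact: reidemeister3.
apply: (@tangle_eq_trans _ [:: (Cross (~~ e), 1); (Cross (~~ ~~ e), 1); (Cross e, 0); (Cross e, 1); (Cross (~~ e), 0)]).
  apply: (@tangle_eq_catr _ [:: (Cross e, 0); (Cross e, 1); (Cross (~~ e), 0)] [::] [:: _; _]) => //.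
  by apply: tangle_eq_sym; apply: tangle_eq_move; first exact: reidemeister2.
rewrite negbK.
apply: (@tangle_eq_trans _ [:: (Cross (~~ e), 1); (Cross e, 0); (Cross e, 1); (Cross e, 0); (Cross (~~ e), 0)]).
  apply: (@tangle_eq_ctx _ [:: _] [:: _] [:: _; _; _] [:: _; _; _]) => //.
  by apply: tangle_eq_sym; apply: tangle_eq_move; first exact: reidemeister3.
apply: (@tangle_eq_catl _ [:: _; _; _] [:: _; _] [::]) => //.
by apply: tangle_eq_move; first exact: reidemeister2.
Qed.

Lemma slide_crossing_up e s : tangle_eq 3
  [:: (Cross e, 1); (Cross e, 0); (Cross s, 1)]
  [:: (Cross s, 0); (Cross e, 1); (Cross e, 0)].
Proof.
have [->|->] : s = e \/ s = ~~ e by case: s e => [] []; auto.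
  by apply: tangle_eq_sym; apply: tangle_eq_move; first exact: reidemeister3.
apply: (@tangle_eq_trans _ [:: (Cross (~~ e), 0); (Cross (~~ ~~ e), 0); (Cross e, 1); (Cross e, 0); (Cross (~~ e), 1)]).
  apply: (@tangle_eq_catr _ [:: (Cross e, 1); (Cross e, 0); (Cross (~~ e), 1)] [::] [:: _; _]) => //.
  by apply: tangle_eq_sym; apply: tangle_eq_move; first exact: reidemeister2.
rewrite negbK.
apply: (@tangle_eq_trans _ [:: (Cross (~~ e), 0); (Cross e, 1); (Cross e, 0); (Cross e, 1); (Cross (~~ e), 1)]).
  apply: (@tangle_eq_ctx _ [:: _] [:: _] [:: _; _; _] [:: _; _; _]) => //.
  by apply: tangle_eq_move; first exact: reidemeister3.
apply: (@tangle_eq_catl _ [:: _; _; _] [:: _; _] [::]) => //.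
by apply: tangle_eq_move; first exact: reidemeister2.
Qed.

Lemma slide_twist i j e X : (i, j) \in [:: (0, 1); (1, 0)] -> tangle_eq 3
  ([:: (Cross e, i); (Cross e, j)] ++ twist i X)
  (twist j X ++ [:: (Cross e, i); (Cross e, j)]).
Proof.
move=> ij; have [fi fj] : i.+2 <= 3 /\ j.+2 <= 3 by move: ij; rewrite !inE => /orP[] /eqP[-> ->].
elim: X => [|s X IH].
  by rewrite cats0; apply: tangle_eq_refl => /=; move: fi fj; lia.
apply: (@tangle_eq_trans _ ([:: (Cross s, j)] ++ ([:: (Cross e, i); (Cross e, j)] ++ twist i X))).
  apply: (@tangle_eq_catr _ (twist i X) [:: _; _; _] [:: _; _; _]).
    by move: ij; rewrite !inE => /orP[] /eqP[-> ->]; [apply: slide_crossing|apply: slide_crossing_up].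
  by have [] := @fits_twist 3 i X fi.
by apply: (@tangle_eq_catl _ [:: _]) => //=; move: fj; lia.
Qed.

(** In braid notation b^-1 a^k = a b^k a^-1 b^-1, by sliding the whole region a^k
    through the two crossings a^-1 b^-1.  This is how a flype turns a twist
    region over. *)
Lemma conj_twist i j e X : (i, j) \in [:: (0, 1); (1, 0)] -> tangle_eq 3
  ([:: (Cross (~~ e), j)] ++ twist i X)
  ([:: (Cross e, i)] ++ twist j X ++ [:: (Cross (~~ e), i); (Cross (~~ e), j)]).
Proof.
move=> ij; have [fi fj] : i.+2 <= 3 /\ j.+2 <= 3 by move: ij; rewrite !inE => /orP[] /eqP[-> ->].
have [ft1 wt1] := fits_twist X fi; have [ft2 wt2] := fits_twist X fj.
apply: (@tangle_eq_trans _ ([:: (Cross e, i); (Cross (~~ e), i)] ++ [:: (Cross (~~ e), j)] ++ twist i X)).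
  apply: (@tangle_eq_catr _ ([:: _] ++ twist i X) [::] [:: _; _]).
    by apply: tangle_eq_sym; apply: tangle_eq_move (reidemeister2 e i) _ _ => //=; move: fi; lia.
  by rewrite /= ft1; move: fj; lia.
apply: (@tangle_eq_catl _ [:: (Cross e, i)]); first by rewrite /=; move: fi; lia.
exact: slide_twist.
Qed.

(** The crossing is turned by a quarter turn when it passes from one leg of a Cap to
    the other, first on the inner Cap and then on the outer one: two quarter turns
    give back the same crossing. *)
Lemma double_cap_crossing i e k : i <= k -> tangle_eq k
  [:: (Cap, i); (Cap, i.+1); (Cross e, i)]
  [:: (Cap, i); (Cap, i.+1); (Cross e, i.+2)].
Proof.
move=> ik; apply: (@tangle_eq_trans _ [:: (Cap, i); (Cap, i); (Cross (~~ e), i.+1)]).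
  apply: (@tangle_eq_catl _ [:: _] [:: _; _] [:: _; _]) => /=; first by lia.
  by apply: tangle_eq_sym; have := slide_cap (~~ e) i; rewrite negbK => mv; apply: tangle_eq_move mv _ _ => /=; lia.
apply: (@tangle_eq_trans _ [:: (Cap, i); (Cap, i.+2); (Cross (~~ e), i.+1)]).
  apply: (@tangle_eq_catr _ [:: _] [:: _; _] [:: _; _]) => /=; last by lia.
  apply: tangle_eq_sym; apply: tangle_eq_move => /=; [|lia|lia].
  by have := far_commute Cap Cap i 0; rewrite /= !addn0 addn2.
apply: (@tangle_eq_catl _ [:: _] [:: _; _] [:: _; _]) => /=; first by lia.
by apply: tangle_eq_sym; apply: tangle_eq_move (slide_cap e i.+1) _ _ => /=; lia.
Qed.

(** The crossing nearest to the maxima slides over first and ends up lowest, hence the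
    reversal. *)
Lemma double_cap_twist i X k : i <= k -> tangle_eq k
  ([:: (Cap, i); (Cap, i.+1)] ++ twist i X)
  ([:: (Cap, i); (Cap, i.+1)] ++ twist i.+2 (rev X)).
Proof.
move=> ik; elim: X => [|s X IH]; first by apply: tangle_eq_refl => /=; lia.
have [F1 W1] := @fits_twist (k + 4) i X ltac:(lia).
have e4 : k - 0 + 2 - 0 + 2 = k + 4 by lia.
rewrite rev_cons.
apply: (@tangle_eq_trans _ ([:: (Cap, i); (Cap, i.+1)] ++ ([:: (Cross s, i.+2)] ++ twist i X))).
  apply: (@tangle_eq_catr _ (twist i X) [:: _; _; _] [:: _; _; _]); first exact: double_cap_crossing.
  have -> : width k [:: (Cap, i); (Cap, i.+1); (Cross s, i)] = k + 4 by move=> /=; lia.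
  exact: F1.
apply: (@tangle_eq_trans _ ([:: (Cap, i); (Cap, i.+1)] ++ (twist i X ++ [:: (Cross s, i.+2)]))).
  apply: (@tangle_eq_catl _ [:: _; _]) => /=; first by lia.
  by rewrite e4 cats1; apply: twist_far_left; rewrite /=; lia.
rewrite /twist map_rcons -cats1 !catA; apply: tangle_eq_catr IH _.
by rewrite width_cat /= e4 W1; lia.
Qed.

(** Turning a twist region by a quarter turn to the left or to the right gives the same
    tangle, since the region is symmetric under a half turn.  The half turn is
    performed by opening a pair of nested maxima, over which the region slides, and
    straightening the strands again. *)
Lemma rotate_twist X : tangle_eq 2
  ([:: (Cap, 2)] ++ twist 1 X ++ [:: (Cup, 0)])
  ([:: (Cap, 0)] ++ twist 1 (rev X) ++ [:: (Cup, 2)]).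
Proof.
have [F4 W4] := @fits_twist 4 1 X isT.
have [F6 W6] := @fits_twist 6 1 X isT.
have [F6' W6'] := @fits_twist 6 3 (rev X) isT.
have [F4' W4'] := @fits_twist 4 1 (rev X) isT.
(* The Cap at 1 and the minimum at 2 zigzag the second strand from above. *)
apply: (@tangle_eq_trans _ ([:: (Cap, 1); (Cup, 2); (Cap, 2)] ++ twist 1 X ++ [:: (Cup, 0)])).
  apply: (@tangle_eq_catr _ ([:: (Cap, 2)] ++ twist 1 X ++ [:: (Cup, 0)]) [::] [:: _; _]).
    by apply: tangle_eq_sym; apply: tangle_eq_move => //; exact: zigzag_right.
  by rewrite /= fits_cat F4 W4.
apply: (@tangle_eq_trans _ ([:: (Cap, 1); (Cap, 2); (Cup, 4)] ++ twist 1 X ++ [:: (Cup, 0)])).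
  apply: (@tangle_eq_ctx _ [:: _] (twist 1 X ++ [:: (Cup, 0)]) [:: _; _] [:: _; _]) => //.
    by apply: tangle_eq_sym; apply: tangle_eq_move => //; apply: (far_commute Cap Cup 2 0).
  by rewrite /= fits_cat F4 W4.
apply: (@tangle_eq_trans _ ([:: (Cap, 1); (Cap, 2)] ++ (twist 1 X ++ [:: (Cup, 4)]) ++ [:: (Cup, 0)])).
  rewrite -catA; apply: (@tangle_eq_catl _ [:: (Cap, 1); (Cap, 2)]) => //=.
  rewrite -(cat_rcons (Cup, 4)); apply: (@tangle_eq_catr _ _ (_ :: twist 1 X)); first exact: twist_far_left.
  by rewrite /= W4.
(* With that minimum below it, the region hangs from two nested maxima. *)
apply: (@tangle_eq_trans _ (([:: (Cap, 1); (Cap, 2)] ++ twist 3 (rev X)) ++ [:: (Cup, 4); (Cup, 0)])).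
  rewrite -(catA (twist 1 X)); apply: (@tangle_eq_catr _ [:: _; _] ([:: _; _] ++ twist 1 X)); first exact: double_cap_twist.
  by rewrite width_cat /= W6.
apply: (@tangle_eq_trans _ (([:: (Cap, 1); (Cap, 2)] ++ twist 3 (rev X)) ++ [:: (Cup, 0); (Cup, 2)])).
  apply: tangle_eq_catl => /=; first exact: F6'.
  by rewrite W6'; apply: tangle_eq_sym; apply: tangle_eq_move => //; apply: (far_commute Cup Cup 0 2).
rewrite -catA.
apply: (@tangle_eq_trans _ ([:: (Cap, 1); (Cap, 2); (Cup, 0)] ++ twist 1 (rev X) ++ [:: (Cup, 2)])).
  apply: (@tangle_eq_catl _ [:: (Cap, 1); (Cap, 2)]) => //=.
  rewrite -(cat_rcons (Cup, 0)); apply: (@tangle_eq_catr _ _ _ (_ :: _)); last by rewrite -cats1 width_cat /= W6'.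
  by apply: tangle_eq_sym; apply: (@twist_far_right Cup 0 1).
apply: (@tangle_eq_trans _ ([:: (Cap, 1); (Cup, 0); (Cap, 0)] ++ twist 1 (rev X) ++ [:: (Cup, 2)])).
  apply: (@tangle_eq_ctx _ [:: _] (twist 1 (rev X) ++ _) [:: _; _] [:: _; _]) => //=.
    by apply: tangle_eq_sym; apply: tangle_eq_move => //; apply: (far_commute Cup Cap 0 0).
  by rewrite fits_cat F4' W4'.
apply: (@tangle_eq_catr _ ([:: (Cap, 0)] ++ twist 1 (rev X) ++ _) [:: _; _] [::]) => //=.
  by apply: tangle_eq_move => //; exact: zigzag_left.
by rewrite fits_cat F4' W4'.
Qed.

Lemma twist_comm i e s k : i.+2 <= k -> tangle_eq k [:: (Cross e, i); (Cross s, i)] [:: (Cross s, i); (Cross e, i)].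
Proof.
move=> ik; have [->|->] : s = e \/ s = ~~ e by case: s e => [] []; auto.
  by apply: tangle_eq_refl => /=; lia.
apply: (@tangle_eq_trans _ [::]); first by apply: tangle_eq_move => /=; [exact: reidemeister2 | lia | ].
apply: tangle_eq_sym; apply: tangle_eq_move => /=; [|lia|by []].
by have := reidemeister2 (~~ e) i; rewrite negbK.
Qed.

(** Crossings on the same two strands commute: they are equal or they cancel. *)
Lemma twist_rot i e X k : i.+2 <= k -> tangle_eq k (twist i (e :: X)) (twist i (rcons X e)).
Proof.
move=> ik; elim: X => [|s X IH] /=; first by apply: tangle_eq_refl; rewrite /=; lia.
have [F W] := fits_twist X ik; have e2 : k - 2 + 2 = k by lia.
apply: (@tangle_eq_trans _ ([:: (Cross s, i)] ++ twist i (e :: X))).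
  by apply: (@tangle_eq_catr _ (twist i X) [:: _; _] [:: _; _]); [apply: twist_comm | rewrite /= !e2].
by apply: (@tangle_eq_catl _ [:: _]) => /=; [lia | rewrite e2].
Qed.

(** * Sums of tangles *)

(** The sum of two tangles with two strands above and two below: the right-hand ends of
    B are joined to the left-hand ends of B'. *)
Definition tsum (B B' : diagram) : diagram :=
  (Cap, 1) :: B ++ shift 2 B' ++ [:: (Cup, 1)].

(** The crossing to the right of the column is brought to its top and conjugates the
    column to the middle strands; what remains is a single crossing above a twist
    region, one crossing longer, turned by a quarter turn. *)
Lemma flype_left X e : tangle_eq 2
  ([:: (Cap, 1)] ++ twist 0 X ++ [:: (Cross e, 2); (Cup, 1)])
  ([:: (Cross e, 0); (Cap, 2)] ++ twist 1 (rcons X e) ++ [:: (Cup, 0)]).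
Proof.
have [F0 W0] := @fits_twist 4 0 X isT; have [F1 W1] := @fits_twist 4 1 X isT.
apply: (@tangle_eq_trans _ ([:: (Cap, 1); (Cross e, 2)] ++ twist 0 X ++ [:: (Cup, 1)])).
  apply: (@tangle_eq_catl _ [:: (Cap, 1)]) => //=.
  rewrite -(cat_rcons (Cross e, 2)); apply: (@tangle_eq_catr _ _ _ (_ :: _)); last by rewrite -cats1 width_cat /= W0.
  by apply: tangle_eq_sym; apply: twist_far_left.
apply: (@tangle_eq_trans _ ([:: (Cap, 2); (Cross (~~ e), 1)] ++ twist 0 X ++ [:: (Cup, 1)])).
  apply: (@tangle_eq_catr _ (twist 0 X ++ _) [:: _; _] [:: _; _]); last by rewrite /= fits_cat F0 W0.
  by apply: tangle_eq_move => //; apply: slide_cap.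
apply: (@tangle_eq_trans _ ([:: (Cap, 2)] ++ ([:: (Cross e, 0)] ++ twist 1 X ++ [:: (Cross (~~ e), 0); (Cross (~~ e), 1)]) ++ [:: (Cup, 1)])).
  apply: (@tangle_eq_ctx _ [:: _] _ (_ :: twist 0 X)) => //=; last by rewrite W0.
  by have := tangle_eq_shift 0 1 (@conj_twist 0 1 e X isT); rewrite !shift0.
apply: (@tangle_eq_trans _ ([:: (Cap, 2); (Cross e, 0)] ++ twist 1 X ++ [:: (Cross (~~ e), 0); (Cup, 1)])).
  rewrite -!catA; apply: (@tangle_eq_catl _ [:: _; _]) => //=; apply: tangle_eq_catl => //.
  rewrite W1; apply: (@tangle_eq_catl _ [:: _]) => //.
  by apply: tangle_eq_move => //; exact: reidemeister1_cup.
apply: (@tangle_eq_trans _ ([:: (Cap, 2); (Cross e, 0)] ++ twist 1 X ++ [:: (Cross e, 1); (Cup, 0)])).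
  apply: (@tangle_eq_catl _ [:: _; _]) => //=; apply: tangle_eq_catl => //.
  by rewrite W1; apply: tangle_eq_sym; apply: tangle_eq_move => //; exact: slide_cup.
rewrite /twist map_rcons -cats1 -!catA -/(twist 1 X).
apply: (@tangle_eq_catr _ (twist 1 X ++ _) [:: _; _] [:: _; _]); last by rewrite fits_cat F1 /= W1.
by apply: tangle_eq_sym; apply: tangle_eq_move => //; apply: (far_commute (Cross e) Cap 0 0).
Qed.

(** The mirror argument for a crossing to the left of the column leads to the same
    crossing above the same region, turned the other way. *)
Lemma flype_right X e : tangle_eq 2
  ([:: (Cap, 1); (Cross e, 0)] ++ twist 2 X ++ [:: (Cup, 1)])
  ([:: (Cross e, 0); (Cap, 0)] ++ twist 1 (rcons X e) ++ [:: (Cup, 2)]).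
Proof.
have [F2 W2] := @fits_twist 4 2 X isT; have [F1 W1] := @fits_twist 4 1 X isT.
apply: (@tangle_eq_trans _ ([:: (Cap, 0); (Cross (~~ e), 1)] ++ twist 2 X ++ [:: (Cup, 1)])).
  apply: (@tangle_eq_catr _ (twist 2 X ++ _) [:: _; _] [:: _; _]); last by rewrite /= fits_cat F2 W2.
  by apply: tangle_eq_sym; apply: tangle_eq_move => //; have := slide_cap (~~ e) 0; rewrite negbK.
apply: (@tangle_eq_trans _ ([:: (Cap, 0)] ++ ([:: (Cross e, 2)] ++ twist 1 X ++ [:: (Cross (~~ e), 2); (Cross (~~ e), 1)]) ++ [:: (Cup, 1)])).
  apply: (@tangle_eq_ctx _ [:: _] _ (_ :: twist 2 X)) => //=; last by rewrite W2.
  have := tangle_eq_shift 1 0 (@conj_twist 1 0 e X isT).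
  by rewrite !shift_cat !shift_twist.
apply: (@tangle_eq_trans _ ([:: (Cap, 0); (Cross e, 2)] ++ twist 1 X ++ [:: (Cross (~~ e), 2); (Cup, 1)])).
  rewrite -!catA; apply: (@tangle_eq_catl _ [:: _; _]) => //=; apply: tangle_eq_catl => //.
  rewrite W1; apply: (@tangle_eq_catl _ [:: _]) => //.
  by apply: tangle_eq_move => //; exact: reidemeister1_cup.
apply: (@tangle_eq_trans _ ([:: (Cap, 0); (Cross e, 2)] ++ twist 1 X ++ [:: (Cross e, 1); (Cup, 2)])).
  apply: (@tangle_eq_catl _ [:: _; _]) => //=; apply: tangle_eq_catl => //.
  rewrite W1; apply: tangle_eq_move => //.
  by have := slide_cup (~~ e) 1; rewrite negbK.
rewrite /twist map_rcons -cats1 -!catA -/(twist 1 X).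
apply: (@tangle_eq_catr _ (twist 1 X ++ _) [:: _; _] [:: _; _]); last by rewrite fits_cat F1 /= W1.
by apply: tangle_eq_move => //; apply: (far_commute Cap (Cross e) 0 0).
Qed.

(** A crossing moves from one side of a column to the other.  After flype_left and
    flype_right both sides show the same twist region, turned by a quarter turn in
    opposite directions, and rotate_twist applies. *)
Lemma flype m s e : tangle_eq 2
  (tsum (twist 0 (nseq m s)) [:: (Cross e, 0)])
  (tsum [:: (Cross e, 0)] (twist 0 (nseq m s))).
Proof.
have E1 := flype_left (nseq m s) e; have E2 := flype_right (nseq m s) e.
rewrite /tsum shift_twist; apply: tangle_eq_trans E1 (tangle_eq_trans _ (tangle_eq_sym E2)).
apply: (@tangle_eq_catl _ [:: (Cross e, 0)]) => //=.
apply: tangle_eq_trans (rotate_twist _) _; rewrite rev_rcons rev_nseq.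
apply: (@tangle_eq_ctx _ [:: (Cap, 0)] [:: (Cup, 2)]) => //; first exact: twist_rot.
by have [_ ->] := fits_twist (e :: nseq m s) (isT : 1.+2 <= width 2 [:: (Cap, 0)]).
Qed.

(** The tangle of slope 0, neutral for tsum. *)
Definition flat : diagram := [:: (Cup, 0); (Cap, 0)].

(** For rational tangles: 1 - 1 = 0. *)
Lemma tsum_cancel e : tangle_eq 2
  (tsum [:: (Cross e, 0)] [:: (Cross (~~ e), 0)]) flat.
Proof.
apply: (@tangle_eq_trans _ [:: (Cap, 1); (Cross e, 0); (Cross e, 1); (Cup, 2)]).
  apply: (@tangle_eq_catl _ [:: _; _] [:: _; _] [:: _; _]) => //.
  by apply: tangle_eq_move => //; have := slide_cup (~~ e) 1; rewrite negbK.
apply: (@tangle_eq_trans _ [:: (Cap, 0); (Cross (~~ e), 1); (Cross e, 1); (Cup, 2)]).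
  apply: (@tangle_eq_catr _ [:: _; _] [:: _; _] [:: _; _]) => //.
  by apply: tangle_eq_sym; apply: tangle_eq_move => //; have := slide_cap (~~ e) 0; rewrite negbK.
apply: (@tangle_eq_trans _ [:: (Cap, 0); (Cup, 2)]).
  apply: (@tangle_eq_ctx _ [:: _] [:: _] [:: _; _] [::]) => //.
  by apply: tangle_eq_move => //; have := reidemeister2 (~~ e) 1; rewrite negbK.
by apply: tangle_eq_move => //; apply: (far_commute Cap Cup 0 0).
Qed.

(** For rational tangles: 1/2 - 1 = - 1/2. *)
Lemma tsum_two s : tangle_eq 2
  (tsum (twist 0 [:: s; s]) [:: (Cross (~~ s), 0)]) (twist 0 [:: ~~ s; ~~ s]).
Proof.
apply: (@tangle_eq_trans _ [:: (Cap, 1); (Cross s, 0); (Cross s, 0); (Cross s, 1); (Cup, 2)]).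
  apply: (@tangle_eq_catl _ [:: _; _; _] [:: _; _] [:: _; _]) => //.
  by apply: tangle_eq_move => //; have := slide_cup (~~ s) 1; rewrite negbK.
apply: (@tangle_eq_trans _ [:: (Cap, 0); (Cross (~~ s), 1); (Cross s, 0); (Cross s, 1); (Cup, 2)]).
  apply: (@tangle_eq_catr _ [:: _; _; _] [:: _; _] [:: _; _]) => //.
  by apply: tangle_eq_sym; apply: tangle_eq_move => //; have := slide_cap (~~ s) 0; rewrite negbK.
apply: (@tangle_eq_trans _ [:: (Cap, 0); (Cross s, 0); (Cross s, 1); (Cross (~~ s), 0); (Cup, 2)]).
  apply: (@tangle_eq_ctx _ [:: _] [:: _] [:: _; _; _] [:: _; _; _]) => //.
  apply: tangle_eq_sym; exact: (tangle_eq_shift 0 1 (slide_crossing s (~~ s))).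
apply: (@tangle_eq_trans _ [:: (Cap, 0); (Cross s, 1); (Cross (~~ s), 0); (Cup, 2)]).
  apply: (@tangle_eq_catr _ [:: _; _; _] [:: _; _] [:: _]) => //.
  by apply: tangle_eq_move => //; exact: reidemeister1_cap.
apply: (@tangle_eq_trans _ [:: (Cap, 1); (Cross (~~ s), 0); (Cross (~~ s), 0); (Cup, 2)]).
  apply: (@tangle_eq_catr _ [:: _; _] [:: _; _] [:: _; _]) => //.
  by apply: tangle_eq_move => //; exact: slide_cap.
apply: (@tangle_eq_trans _ [:: (Cap, 1); (Cross (~~ s), 0); (Cup, 2); (Cross (~~ s), 0)]).
  apply: (@tangle_eq_catl _ [:: _; _] [:: _; _] [:: _; _]) => //.
  by apply: tangle_eq_move => //; apply: (far_commute (Cross _) Cup 0 0).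
apply: (@tangle_eq_trans _ [:: (Cap, 1); (Cup, 2); (Cross (~~ s), 0); (Cross (~~ s), 0)]).
  apply: (@tangle_eq_ctx _ [:: _] [:: _] [:: _; _] [:: _; _]) => //.
  by apply: tangle_eq_move => //; apply: (far_commute (Cross _) Cup 0 0).
apply: (@tangle_eq_catr _ [:: _; _] [:: _; _] [::]) => //.
by apply: tangle_eq_move => //; exact: zigzag_right.
Qed.

Definition block (B : diagram) : bool := fits 2 B && (width 2 B == 2).

Lemma block_shift a b B : block B ->
  fits (a + 2 + b) (shift a B) /\ width (a + 2 + b) (shift a B) = a + 2 + b.
Proof. by case/andP=> fB /eqP wB; have := fits_shift a b fB; rewrite wB. Qed.

Lemma block_shift_le a k B : block B -> a + 2 <= k ->
  fits k (shift a B) /\ width k (shift a B) = k.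
Proof. by move=> bB ak; rewrite -(subnKC ak); apply: block_shift. Qed.

Lemma block_tsum B B' : block B -> block B' -> block (tsum B B').
Proof.
move=> bB bB'; have [f1 w1] := block_shift_le bB (isT : 0 + 2 <= 4).
have [f2 w2] := block_shift_le bB' (isT : 2 + 2 <= 4).
rewrite shift0 in f1 w1.
by rewrite /block /= !fits_cat !width_cat f1 w1 f2 w2.
Qed.

Lemma block_flat : block flat. Proof. by []. Qed.

Lemma tsum_flat_l B : block B -> tangle_eq 2 (tsum flat B) B.
Proof.
move=> bB; have [f2 w2] := block_shift_le bB (isT : 2 + 2 <= 4).
have /andP[fB /eqP wB] := bB.
apply: (@tangle_eq_trans _ ([:: (Cap, 1); (Cup, 0)] ++ B ++ [:: (Cap, 0); (Cup, 1)])).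
  apply: (@tangle_eq_trans _ ([:: (Cap, 1); (Cup, 0)] ++ ([:: (Cap, 0)] ++ shift 2 B) ++ [:: (Cup, 1)])).
    by apply: tangle_eq_refl; rewrite /= fits_cat f2 w2.
  rewrite -(cat_rcons (Cap, 0)).
  apply: (@tangle_eq_ctx _ [:: _; _] [:: _] (_ :: shift 2 B)) => //=; last by rewrite w2.
  have := @tangle_eq_interchange 0 2 [:: (Cap, 0)] B isT fB.
  by rewrite shift0 cats1.
apply: (@tangle_eq_trans _ ([::] ++ B ++ [:: (Cap, 0); (Cup, 1)])).
  apply: (@tangle_eq_catr _ (B ++ _) [:: _; _] [::]); last by rewrite /= fits_cat fB wB.
  by apply: tangle_eq_move => //; exact: zigzag_left.
rewrite /= -{2}(cats0 B); apply: tangle_eq_catl => //; rewrite wB.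
by apply: tangle_eq_move => //; exact: zigzag_right.
Qed.

Lemma tsum_flat_r B : block B -> tangle_eq 2 (tsum B flat) B.
Proof.
move=> bB; have [f0 w0] := block_shift_le bB (isT : 0 + 2 <= 4).
have /andP[fB /eqP wB] := bB; rewrite shift0 in f0 w0.
apply: (@tangle_eq_trans _ ([:: (Cap, 1); (Cup, 2)] ++ B ++ [:: (Cap, 2); (Cup, 1)])).
  apply: (@tangle_eq_catl _ [:: _]) => //=.
  rewrite -(cat_rcons (Cup, 2)); apply: (@tangle_eq_catr _ _ _ (_ :: _)) => /=; last first.
    by rewrite -cats1 width_cat w0.
  have := @tangle_eq_interchange 2 2 B [:: (Cup, 0)] fB isT.
  by rewrite cats1 wB.
apply: (@tangle_eq_trans _ ([::] ++ B ++ [:: (Cap, 2); (Cup, 1)])).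
  apply: (@tangle_eq_catr _ (B ++ _) [:: _; _] [::]); last by rewrite /= fits_cat fB wB.
  by apply: tangle_eq_move => //; exact: zigzag_right.
rewrite /= -{2}(cats0 B); apply: tangle_eq_catl => //; rewrite wB.
by apply: tangle_eq_move => //; exact: zigzag_left.
Qed.

(** * Cyclic closures of sums *)

Fixpoint row (j : nat) (Bs : seq diagram) : diagram :=
  if Bs is B :: Bs' then shift j B ++ row j.+2 Bs' else [::].

(** The cyclic closure of a sum of tangles, drawn as pretzel draws its columns. *)
Definition necklace (Bs : seq diagram) : diagram :=
  (Cap, 0) :: nseq (size Bs).-1 (Cap, 1) ++ row 0 Bs
    ++ rcons (nseq (size Bs).-1 (Cup, 1)) (Cup, 0).

Lemma row_cat j Bs Bs' : row j (Bs ++ Bs') = row j Bs ++ row (j + (size Bs).*2) Bs'.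
Proof.
elim: Bs j => [|B Bs IH] j /=; first by rewrite addn0.
by rewrite IH catA doubleS !addSnnS.
Qed.

Lemma shift_row a j Bs : shift a (row j Bs) = row (a + j) Bs.
Proof. by elim: Bs j => //= B Bs IH j; rewrite shift_cat shiftD IH !addnS. Qed.

Lemma fits_row k j Bs : all block Bs -> j + (size Bs).*2 <= k ->
  fits k (row j Bs) /\ width k (row j Bs) = k.
Proof.
elim: Bs j => //= B Bs IH j /andP[bB bBs] jk.
have [f w] : fits k (shift j B) /\ width k (shift j B) = k.
  by apply: block_shift_le => //; lia.
by rewrite fits_cat width_cat f w; apply: IH => //; lia.
Qed.

Lemma fits_caps k m : 0 < k -> fits k (nseq m (Cap, 1)) /\ width k (nseq m (Cap, 1)) = k + m.*2.
Proof.
move=> k0; elim: m k k0 => [|m IH] k k0 /=; first by rewrite addn0.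
by have [-> ->] := IH (k - 0 + 2) ltac:(lia); lia.
Qed.

Lemma fits_cups k m : 1 < k -> fits (k + m.*2) (nseq m (Cup, 1)) /\ width (k + m.*2) (nseq m (Cup, 1)) = k.
Proof.
move=> k0; elim: m => [|m IH] /=; first by rewrite addn0.
have -> : k + m.+1.*2 - 2 + 0 = k + m.*2 by lia.
by have [-> ->] := IH; lia.
Qed.

Lemma nseq_rcons T m (x : T) : nseq m.+1 x = nseq m x ++ [:: x].
Proof. by rewrite -addn1 nseqD. Qed.

(** The maximum between columns i and i + 1 can be taken as the last one, where it has
    position 2 i + 1: the maxima to its left, which are inserted later at position
    1, commute with it. *)
Lemma caps_swap k i m : i <= m -> 1 < k -> tangle_eq k
  (nseq m (Cap, 1) ++ [:: (Cap, i.*2.+1)]) (nseq m.+1 (Cap, 1)).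
Proof.
move=> im k0; elim: i m im => [|i IH] m im.
  by rewrite -nseq_rcons; apply: tangle_eq_refl; have [] := @fits_caps k m.+1 ltac:(lia).
case: m im => // m im.
rewrite (nseq_rcons m.+1) {1}nseq_rcons -(catA (nseq m _)).
have [f w] := @fits_caps k m ltac:(lia).
apply: (@tangle_eq_trans _ (nseq m (Cap, 1) ++ [:: (Cap, i.*2.+1); (Cap, 1)])).
  apply: tangle_eq_catl => //; rewrite w; apply: tangle_eq_move => /=; [|lia|lia].
  by have := far_commute Cap Cap 1 i.*2; rewrite /= addn0 doubleS.
rewrite (catA (nseq m _) [:: _] [:: _]).
by apply: tangle_eq_catr (IH m im) _; rewrite width_cat w /=; lia.
Qed.

Lemma cups_swap k i m : i <= m -> 1 < k -> tangle_eq (k + m.+1.*2)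
  ((Cup, i.*2.+1) :: nseq m (Cup, 1)) (nseq m.+1 (Cup, 1)).
Proof.
move=> im k0; elim: i m im => [|i IH] m im.
  by apply: tangle_eq_refl; have [] := @fits_cups k m.+1 k0.
case: m im => // m im; have [f w] := @fits_cups k m k0.
apply: (@tangle_eq_trans _ ([:: (Cup, 1); (Cup, i.*2.+1)] ++ nseq m (Cup, 1))).
  apply: (@tangle_eq_catr _ (nseq m (Cup, 1)) [:: _; _] [:: _; _]).
    apply: tangle_eq_sym; apply: tangle_eq_move => /=; [|lia|lia].
    by have := far_commute Cup Cup 1 i.*2; rewrite /= addn0 doubleS.
  by have <- : k + m.*2 = width (k + m.+2.*2) [:: (Cup, i.+1.*2.+1); (Cup, 1)] by move=> /=; lia.
apply: (@tangle_eq_catl _ [:: (Cup, 1)]) => /=; first by lia.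
have -> : k + m.+2.*2 - 2 + 0 = k + m.+1.*2 by lia.
exact: IH.
Qed.

Definition enclose (m : nat) (w : diagram) : diagram :=
  (Cap, 0) :: nseq m (Cap, 1) ++ w ++ rcons (nseq m (Cup, 1)) (Cup, 0).

Lemma necklaceE L1 B L2 : necklace (L1 ++ B :: L2) =
  enclose (size L1 + size L2)
    (row 0 L1 ++ shift (size L1).*2 B ++ row (size L1).*2.+2 L2).
Proof. by rewrite /necklace size_cat addnS row_cat. Qed.

Lemma fits_close m : fits m.+1.*2 (rcons (nseq m (Cup, 1)) (Cup, 0)) /\
  width m.+1.*2 (rcons (nseq m (Cup, 1)) (Cup, 0)) = 0.
Proof.
have [f w] := @fits_cups 2 m isT.
have -> : m.+1.*2 = 2 + m.*2 by lia.
by rewrite -cats1 fits_cat width_cat f w.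
Qed.

Lemma enclose_teq m w w' : tangle_eq m.+1.*2 w w' -> width m.+1.*2 w = m.+1.*2 ->
  tangle_eq 0 (enclose m w) (enclose m w').
Proof.
move=> E ew; have [fc wc] := @fits_caps 2 m isT; have [f0 w0] := fits_close m.
have e2 : 2 + m.*2 = m.+1.*2 by lia.
apply: (@tangle_eq_ctx 0 (_ :: nseq m (Cap, 1))) => /=; first exact: fc.
  by rewrite wc e2.
by rewrite wc e2 ew.
Qed.

Lemma necklace_teq L1 B B' L2 : all block L1 -> block B -> all block L2 ->
  tangle_eq 2 B B' -> tangle_eq 0 (necklace (L1 ++ B :: L2)) (necklace (L1 ++ B' :: L2)).
Proof.
move=> b1 bB b2 E; rewrite !necklaceE.
set K := (size L1 + size L2).+1.*2.
have [f1 w1] : fits K (row 0 L1) /\ width K (row 0 L1) = K by apply: fits_row => //; lia.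
have [f2 w2] : fits K (row (size L1).*2.+2 L2) /\ width K (row (size L1).*2.+2 L2) = K.
  by apply: fits_row => //; lia.
have [fB wB] : fits K (shift (size L1).*2 B) /\ width K (shift (size L1).*2 B) = K.
  by apply: block_shift_le => //; lia.
apply: enclose_teq; last by rewrite !width_cat w1 wB w2.
apply: tangle_eq_ctx => //; rewrite w1; last by rewrite wB.
have := tangle_eq_shift (size L1).*2 (size L2).*2 E.
by have -> : (size L1).*2 + 2 + (size L2).*2 = K by lia.
Qed.

(** Two adjacent columns may be treated as one: the maximum and the minimum that join
    them are brought next to them, which leaves the diagram of a necklace with one
    column less. *)
Lemma necklace_tsum L1 B B' L2 :
  all block L1 -> block B -> block B' -> all block L2 ->
  tangle_eq 0 (necklace (L1 ++ tsum B B' :: L2)) (necklace (L1 ++ B :: B' :: L2)).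
Proof.
move=> b1 bB bB' b2; rewrite !necklaceE.
set j := (size L1).*2; set m := size L1 + size L2.
have -> : size L1 + size (B' :: L2) = m.+1 by rewrite /= addnS.
have -> : row j.+2 (B' :: L2) = shift j.+2 B' ++ row j.+4 L2 by [].
have -> : shift j (tsum B B') = (Cap, j.+1) :: shift j B ++ shift j.+2 B' ++ [:: (Cup, j.+1)].
  rewrite -(addn2 j) -(addn1 j) -shiftD.
  by rewrite -[in RHS](cat1s (Cap, _)) /tsum -cat1s !shift_cat.
set K := m.+1.*2.
have jK : j.+1 + 0 <= K by lia. have eL : j.+4 + (size L2).*2 = K.+2 by lia.
have eL' : j + (size L2).+1.*2 = K by lia. have ej : j.+4 - 2 + 0 = j.+2 by lia.
have jK2 : j.+3 <= K.+2 by lia. have iL : size L1 <= m by lia.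
have jK4 : j.+2 <= j.+4 by lia. have jK5 : j.+1 + 2 <= K.+2 by lia.
have eK : 2 + m.*2 = K by lia. have eK2 : 2 + m.+1.*2 = K.+2 by lia.
have eK' : K - 0 + 2 = K.+2 by lia. have eK'' : K.+2 - 2 + 0 = K by lia.
have [f1 w1] : fits K (row 0 L1) /\ width K (row 0 L1) = K by apply: fits_row => //; lia.
have [f1' w1'] : fits K.+2 (row 0 L1) /\ width K.+2 (row 0 L1) = K.+2 by apply: fits_row => //; lia.
have [f2 w2] : fits K (row j.+2 L2) /\ width K (row j.+2 L2) = K.
  by apply: fits_row => //; lia.
have [f2' w2'] : fits K.+2 (row j.+4 L2) /\ width K.+2 (row j.+4 L2) = K.+2.
  by apply: fits_row => //; lia.
have [fB wB] : fits K.+2 (shift j B) /\ width K.+2 (shift j B) = K.+2.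
  by apply: block_shift_le => //; lia.
have [fB' wB'] : fits K.+2 (shift j.+2 B') /\ width K.+2 (shift j.+2 B') = K.+2.
  by apply: block_shift_le => //; lia.
have [f0 w0] := fits_close m; have [fc wc] := @fits_caps 2 m isT.
have [fq wq] := @fits_cups 2 m isT.
rewrite eK in fq wq wc; rewrite -/K in f0 w0.
pose M := row 0 L1 ++ shift j B ++ shift j.+2 B' ++ row j.+4 L2.
have ftB : fits K.+2 M /\ width K.+2 M = K.+2.
  by rewrite /M !fits_cat !width_cat f1' w1' fB wB fB' wB' f2' w2'.
have [fM wM] := ftB.
apply: (@tangle_eq_trans _ (enclose m ((Cap, j.+1) :: M ++ [:: (Cup, j.+1)]))).
  apply: enclose_teq; last first.
    rewrite !width_cat w1 /= !width_cat eK' wB wB' /= eK'' w2 //.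
  apply: (@tangle_eq_trans _ (rcons (row 0 L1) (Cap, j.+1) ++ shift j B ++ shift j.+2 B' ++ (row j.+4 L2 ++ [:: (Cup, j.+1)]))).
    rewrite cat_rcons !cat_cons -!catA.
    apply: tangle_eq_catl => //; rewrite w1; apply: (@tangle_eq_catl _ [:: _]) => /=; first by rewrite jK.
    rewrite eK'; apply: tangle_eq_catl => //; rewrite wB; apply: tangle_eq_catl => //; rewrite wB'.
    have := @tangle_eq_interchange j.+4 (size L2).*2 [:: (Cup, j.+1)] (row 0 L2).
    rewrite !shift_row !addn0 /= ej eL; apply; last exact: (proj1 (@fits_row _ 0 L2 b2 (leqnn _))).
    by rewrite /= addn2 leqnSn.
  rewrite /M -!catA -cat_cons; apply: tangle_eq_catr; last first.
    by rewrite -cats1 width_cat w1 /= eK' !fits_cat fB wB fB' wB' f2' w2' /= jK5.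
  have := @tangle_eq_interchange j (size L2).+1.*2 (row 0 L1) [:: (Cap, 1)] (proj1 (@fits_row _ 0 L1 b1 (leqnn _))) isT.
  rewrite (proj2 (@fits_row _ 0 L1 b1 (leqnn _))) cats1 /= addn1 eL'.
  exact.
have -> : enclose m ((Cap, j.+1) :: M ++ [:: (Cup, j.+1)]) =
  [:: (Cap, 0)] ++ (nseq m (Cap, 1) ++ [:: (Cap, j.+1)]) ++ M ++ ((Cup, j.+1) :: nseq m (Cup, 1)) ++ [:: (Cup, 0)].
  by rewrite /enclose -cats1 /= -!catA.
have -> : enclose m.+1 M =
  [:: (Cap, 0)] ++ nseq m.+1 (Cap, 1) ++ M ++ nseq m.+1 (Cup, 1) ++ [:: (Cup, 0)].
  by rewrite /enclose -cats1.
apply: (@tangle_eq_catl _ [:: (Cap, 0)]) => //.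
apply: (@tangle_eq_trans _ (nseq m.+1 (Cap, 1) ++ M ++ ((Cup, j.+1) :: nseq m (Cup, 1)) ++ [:: (Cup, 0)])).
  apply: tangle_eq_catr; first by apply: caps_swap.
  rewrite width_cat wc /= eK' fits_cat fM wM /= eK'' fits_cat fq wq.
  by rewrite andbT jK5.
have [fc2 wc2] := @fits_caps 2 m.+1 isT.
apply: tangle_eq_catl => //; rewrite wc2 eK2; apply: tangle_eq_catl => //; rewrite wM.
rewrite -eK2.
apply: tangle_eq_catr; first by apply: cups_swap.
by rewrite eK2 /= eK'' wq.
Qed.

Lemma necklace_flat L1 L2 : all block L1 -> all block L2 -> 0 < size (L1 ++ L2) ->
  tangle_eq 0 (necklace (L1 ++ flat :: L2)) (necklace (L1 ++ L2)).
Proof.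
move=> b1; case: L2 => [_|B L2 /= /andP[bB b2] _].
  case/lastP: L1 b1 => // L1 B; rewrite all_rcons => /andP[bB b1] _.
  rewrite cats0 cat_rcons -cats1.
  apply: tangle_eq_trans (tangle_eq_sym (@necklace_tsum L1 B flat [::] b1 bB block_flat isT)) _.
  by apply: necklace_teq => //; [apply: block_tsum | apply: tsum_flat_r].
apply: tangle_eq_trans (tangle_eq_sym (necklace_tsum b1 block_flat bB b2)) _.
by apply: necklace_teq => //; [apply: block_tsum | apply: tsum_flat_l].
Qed.

(** * Moves between pretzel links *)

Definition column (x : int) : diagram := twist 0 (nseq `|x|%N (0 < x)%R).

Lemma twistsE x i : twists x i = shift i.*2 (column x).
Proof. by rewrite /column shift_twist addn0 /twists /twist map_nseq. Qed.

Lemma pretzelE c : pretzel c = necklace (map column c).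
Proof.
rewrite /pretzel /necklace size_map; congr (_ :: _ ++ _ ++ _).
have E s j : flatten [seq twists (s`_(i - j))%R i | i <- iota j (size s)] = row j.*2 (map column s).
  elim: s j => //= x s IH j; rewrite subnn twistsE -doubleS -IH.
  congr (_ ++ flatten _); apply/eq_in_map => i; rewrite mem_iota => /andP[ji _].
  by rewrite -[i - j]prednK ?subn_gt0 // -subnS.
by rewrite -(E c 0); congr flatten; apply: eq_map => i; rewrite subn0.
Qed.

Lemma block_column x : block (column x).
Proof.
have [f w] := @fits_twist 2 0 (nseq `|x|%N (0 < x)%R) isT.
by rewrite /block /column f w.
Qed.

Lemma blocks_columns s : all block (map column s).
Proof. by elim: s => //= x s ->; rewrite block_column. Qed.

Definition same_pretzel (c c' : seq int) : Prop := tangle_eq 0 (pretzel c) (pretzel c').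

Lemma fits_necklace Bs : 0 < size Bs -> all block Bs ->
  fits 0 (necklace Bs) /\ width 0 (necklace Bs) = 0.
Proof.
case: Bs => // B Bs _ bBs; set m := size Bs.
have -> : necklace (B :: Bs) =
  (Cap, 0) :: nseq m (Cap, 1) ++ row 0 (B :: Bs) ++ rcons (nseq m (Cup, 1)) (Cup, 0).
  by [].
have [fc wc] := @fits_caps 2 m isT; have [f0 w0] := fits_close m.
have [f w] := @fits_row m.+1.*2 0 (B :: Bs) bBs (leqnn _).
have e2 : 2 + m.*2 = m.+1.*2 by lia.
rewrite e2 in wc; move: (row 0 (B :: Bs)) f w => W f w.
by rewrite -cat1s !fits_cat !width_cat -[width 0 [:: _]]/2 wc w fc f f0 w0.
Qed.

Lemma closed_pretzel c : c != [::] -> closed_diagram (pretzel c).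
Proof.
move=> c0; rewrite /closed_diagram closed_fits pretzelE.
have s0 : 0 < size (map column c) by rewrite size_map lt0n size_eq0.
by have [-> ->] := fits_necklace s0 (blocks_columns c).
Qed.

Lemma same_pretzel_refl c : same_pretzel c c.
Proof.
case: c => [|x c]; first exact: tangle_eq_refl.
by apply: tangle_eq_refl; have := @closed_pretzel (x :: c) isT; rewrite /closed_diagram closed_fits => /andP[].
Qed.

Lemma same_pretzel_trans c2 c1 c3 :
  same_pretzel c1 c2 -> same_pretzel c2 c3 -> same_pretzel c1 c3.
Proof. exact: tangle_eq_trans. Qed.

Lemma same_pretzel_sym c c' : same_pretzel c c' -> same_pretzel c' c.
Proof. exact: tangle_eq_sym. Qed.

Lemma same_pretzel_tsum c1 x y c2 B :
  tangle_eq 2 (tsum (column x) (column y)) B -> block B ->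
  tangle_eq 0 (pretzel (c1 ++ x :: y :: c2)) (necklace (map column c1 ++ B :: map column c2)).
Proof.
move=> E bB; rewrite pretzelE map_cat /=.
have b := blocks_columns; have bc := block_column.
apply: tangle_eq_trans (tangle_eq_sym (necklace_tsum _ _ _ _)) _ => //.
by apply: necklace_teq => //; apply: block_tsum.
Qed.

Lemma column_unit e : column (sgn e) = [:: (Cross e, 0)].
Proof. by case: e. Qed.

(** The flype, for columns inside a pretzel link. *)
Lemma swap_unit c1 x e c2 :
  same_pretzel (c1 ++ x :: sgn e :: c2) (c1 ++ sgn e :: x :: c2).
Proof.
have b := blocks_columns; have bc := block_column.
apply: (@tangle_eq_trans _ (necklace (map column c1 ++ tsum (column (sgn e)) (column x) :: map column c2))).
  apply: same_pretzel_tsum; last exact: block_tsum.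
  by rewrite column_unit; apply: flype.
apply: tangle_eq_sym; apply: same_pretzel_tsum; last exact: block_tsum.
by apply: tangle_eq_refl; have /andP[] := block_tsum (bc (sgn e)) (bc x).
Qed.

(** The sum of the two columns is the flat tangle, which disappears as soon as there is
    another column to add it to. *)
Lemma cancel_units c1 e c2 : 0 < size (c1 ++ c2) ->
  same_pretzel (c1 ++ sgn e :: sgn (~~ e) :: c2) (c1 ++ c2).
Proof.
move=> s0; have b := blocks_columns.
apply: (@tangle_eq_trans _ (necklace (map column c1 ++ flat :: map column c2))).
  by apply: same_pretzel_tsum => //; rewrite !column_unit; apply: tsum_cancel.
rewrite pretzelE map_cat; apply: necklace_flat => //.
by rewrite -map_cat size_map.
Qed.

Lemma absorb_unit c1 e c2 :
  same_pretzel (c1 ++ (2 * sgn e)%R :: sgn (~~ e) :: c2) (c1 ++ (2 * sgn (~~ e))%R :: c2).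
Proof.
have b := blocks_columns.
have E f : column (2 * sgn f)%R = twist 0 [:: f; f] by case: f.
rewrite /same_pretzel (pretzelE (c1 ++ (2 * sgn (~~ e))%R :: c2)) map_cat map_cons E.
apply: same_pretzel_tsum; last by rewrite -E block_column.
by rewrite E column_unit; apply: tsum_two.
Qed.

(** * Pretzel diagrams of the unknot *)

Lemma kinks X : tangle_eq 0 ((Cap, 0) :: twist 0 X ++ [:: (Cup, 0)]) circle.
Proof.
elim: X => [|s X IH] /=; first exact: tangle_eq_refl.
apply: tangle_eq_trans IH.
apply: (@tangle_eq_catr _ (twist 0 X ++ [:: (Cup, 0)]) [:: _; _] [:: _]).
  by apply: tangle_eq_move => //; exact: reidemeister1_cap.
by have [f w] := @fits_twist 2 0 X isT; rewrite /= fits_cat f w.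
Qed.

Lemma unknotted_one a : unknotted (pretzel [:: a]).
Proof.
apply: tangle_eq_isotopic; first exact: closed_pretzel.
by rewrite pretzelE /necklace /= cats0 shift0; apply: kinks.
Qed.

Lemma cancel_twist i m p s k : i.+2 <= k ->
  tangle_eq k (twist i (nseq (m + p) s ++ nseq m (~~ s))) (twist i (nseq p s)).
Proof.
move=> ik; elim: m => [|m IH]; first by rewrite cats0; apply: tangle_eq_refl; have [] := fits_twist (nseq p s) ik.
apply: tangle_eq_trans IH; rewrite addSn nseq_rcons -catA /twist !map_cat.
have ft Y := fits_twist Y ik.
have [f1 w1] := ft (nseq (m + p) s); have [f2 w2] := ft (nseq m (~~ s)).
apply: tangle_eq_catl => //; rewrite w1.
apply: (@tangle_eq_catr _ (twist i (nseq m (~~ s))) [:: _; _] [::]).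
  by apply: tangle_eq_move (reidemeister2 s i) _ _ => //=; lia.
by have -> : width k [:: (Cross s, i); (Cross (~~ s), i)] = k by move=> /=; lia.
Qed.

Lemma twist_catC i X Y k : i.+2 <= k -> tangle_eq k (twist i (X ++ Y)) (twist i (Y ++ X)).
Proof.
move=> ik; elim: X Y => [|e X IH] Y; first by rewrite cats0; apply: tangle_eq_refl; have [] := fits_twist Y ik.
apply: tangle_eq_trans (twist_rot e (X ++ Y) ik) _.
by rewrite rcons_cat -cat_rcons; apply: IH.
Qed.

(** The diagram begins with two nested maxima, so the right-hand column slides over them
    onto the two strands of the left-hand one. *)
Lemma two_columns_twist X Y : tangle_eq 0
  ([:: (Cap, 0); (Cap, 1)] ++ twist 0 X ++ twist 2 Y ++ [:: (Cup, 1); (Cup, 0)])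
  ([:: (Cap, 0); (Cap, 1)] ++ twist 0 (rev Y ++ X) ++ [:: (Cup, 1); (Cup, 0)]).
Proof.
have [fX wX] := @fits_twist 4 0 X isT; have [fY wY] := @fits_twist 4 2 Y isT.
apply: (@tangle_eq_trans _ ([:: (Cap, 0); (Cap, 1)] ++ twist 2 Y ++ twist 0 X ++ [:: (Cup, 1); (Cup, 0)])).
  apply: (@tangle_eq_catl _ [:: _; _]) => //=; rewrite !(catA (twist _ _)).
  apply: tangle_eq_catr; last by rewrite width_cat wX wY.
  have [fX2 wX2] := @fits_twist 2 0 X isT; have [fY2 wY2] := @fits_twist 2 0 Y isT.
  by have := tangle_eq_interchange fX2 fY2; rewrite wX2 !shift_twist.
rewrite /twist map_cat -catA.
apply: (@tangle_eq_catr _ (twist 0 X ++ _) ([:: _; _] ++ twist 2 Y) ([:: _; _] ++ twist 0 (rev Y))); last first.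
  by rewrite /= wY fits_cat fX wX.
by apply: tangle_eq_sym; have := @double_cap_twist 0 (rev Y) 0 isT; rewrite revK.
Qed.

Lemma two_columns_kink s : tangle_eq 0
  ([:: (Cap, 0); (Cap, 1)] ++ twist 0 [:: s] ++ [:: (Cup, 1); (Cup, 0)]) circle.
Proof.
apply: (@tangle_eq_trans _ [:: (Cap, 0); (Cap, 0); (Cross (~~ s), 1); (Cup, 1); (Cup, 0)]).
  apply: (@tangle_eq_ctx _ [:: _] [:: _; _] [:: _; _] [:: _; _]) => //.
  by apply: tangle_eq_sym; apply: tangle_eq_move => //; have := slide_cap (~~ s) 0; rewrite negbK.
apply: (@tangle_eq_trans _ [:: (Cap, 0); (Cap, 0); (Cup, 1); (Cup, 0)]).
  apply: (@tangle_eq_ctx _ [:: _; _] [:: _] [:: _; _] [:: _]) => //.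
  by apply: tangle_eq_move => //; exact: reidemeister1_cup.
apply: (@tangle_eq_ctx _ [:: _] [:: _] [:: _; _] [::]) => //.
by apply: tangle_eq_move => //; exact: zigzag_right.
Qed.

Lemma unknotted_two a b : `|a + b|%R = 1%R -> unknotted (pretzel [:: a; b]).
Proof.
move=> ab; apply: tangle_eq_isotopic; first exact: closed_pretzel.
rewrite pretzelE /necklace /= cats0 shift0 shift_twist -catA.
apply: tangle_eq_trans (two_columns_twist _ _) _; rewrite rev_nseq.
suff [s E] : exists s, tangle_eq 4 (twist 0 (nseq `|b|%N (0 < b)%R ++ nseq `|a|%N (0 < a)%R)) (twist 0 [:: s]).
  apply: tangle_eq_trans (two_columns_kink s).
  by apply: (@tangle_eq_ctx 0 [:: _; _] [:: _; _]) => //; have [_ _ ->] := E.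
have red m s : tangle_eq 4 (twist 0 (nseq m.+1 s ++ nseq m (~~ s))) (twist 0 [:: s]).
  by have := @cancel_twist 0 m 1 s 4 isT; rewrite addn1.
have red' m s : tangle_eq 4 (twist 0 (nseq m (~~ s) ++ nseq m.+1 s)) (twist 0 [:: s]).
  by apply: tangle_eq_trans (red m s); apply: twist_catC.
have posE n : nseq n (0 < Posz n)%R = nseq n true by case: n.
case: a b ab => m [] n; rewrite /absz => ab.
- have [[-> ->]|[-> ->]] : (m = 1 /\ n = 0) \/ (m = 0 /\ n = 1) by lia.
    by exists true; apply: tangle_eq_refl.
  by exists true; apply: tangle_eq_refl.
- rewrite posE; have [->|->] : m = n.+2 \/ m = n by lia.
    by exists true; apply: (red' n.+1 true).
  by exists false; apply: (red n false).
- rewrite posE; have [->|->] : n = m.+2 \/ n = m by lia.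
    by exists true; apply: (red m.+1 true).
  by exists false; apply: (red' m false).
- lia.
Qed.

(** * Gathering the columns with one crossing *)

Definition long_columns (c : seq int) := [seq x <- c | 1 < `|x|%N].

Lemma units_move c1 x a e c2 :
  same_pretzel (c1 ++ x :: nseq a (sgn e) ++ c2) (c1 ++ nseq a (sgn e) ++ x :: c2).
Proof.
elim: a c1 => [|a IH] c1; first exact: same_pretzel_refl.
apply: same_pretzel_trans (swap_unit _ _ _ _) _.
by have := IH (rcons c1 (sgn e)); rewrite !cat_rcons.
Qed.

(** The prefix pre is the part of the link that the induction has passed already. *)
Lemma sort_units pre c : all (fun x => x != 0%R) c ->
  same_pretzel (pre ++ c)
    (pre ++ nseq (count_mem 1%R c) 1%R ++ nseq (count_mem (-1)%R c) (-1)%R ++ long_columns c).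
Proof.
elim: c pre => [|x c IH] pre /= => [_|/andP[x0 c0]]; first exact: same_pretzel_refl.
have {IH} := IH (rcons pre x) c0; rewrite !cat_rcons => /same_pretzel_trans; apply.
have [->|x1] := eqVneq x 1%R; first exact: same_pretzel_refl.
rewrite add0n; apply: same_pretzel_trans (units_move _ _ _ true _) _.
have [->|x2] := eqVneq x (-1)%R; first exact: same_pretzel_refl.
have -> : 1 < `|x| by lia.
rewrite add0n catA; apply: same_pretzel_trans (units_move _ _ _ false _) _.
by rewrite -catA; apply: same_pretzel_refl.
Qed.

Lemma cancel_all_units a b (o : seq int) : 0 < (a - b) + (b - a) + size o ->
  same_pretzel (nseq a (1 : int)%R ++ nseq b (-1 : int)%R ++ o)
    (nseq (a - b) 1%R ++ nseq (b - a) (-1)%R ++ o).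
Proof.
elim: a b => [|a IH] [|b] s0; rewrite ?subn0 ?sub0n; try exact: same_pretzel_refl.
rewrite !subSS in s0 *; apply: same_pretzel_trans (IH _ s0).
rewrite nseq_rcons -catA; apply: (@cancel_units (nseq a 1%R) true (nseq b (-1)%R ++ o)).
by rewrite !size_cat !size_nseq; lia.
Qed.

Lemma pretzel_normal_form c a b : all (fun x => x != 0%R) c ->
  (count_mem 1%R c + b = count_mem (-1)%R c + a)%N ->
  (a = 0 \/ b = 0) -> 0 < a + b + size (long_columns c) ->
  same_pretzel c (nseq a 1%R ++ nseq b (-1)%R ++ long_columns c).
Proof.
move=> c0 e ab s0.
apply: same_pretzel_trans (@sort_units [::] c c0) _.
set m := count_mem _ _ in e *; set n := count_mem _ _ in e *.
have [-> ->] : a = m - n /\ b = n - m by lia.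
by apply: cancel_all_units; lia.
Qed.

Lemma unknotted_same c c' : c != [::] -> same_pretzel c c' ->
  unknotted (pretzel c') -> unknotted (pretzel c).
Proof. by move=> c0 E; apply: rst_trans; apply: tangle_eq_isotopic E; apply: closed_pretzel. Qed.

(** By flypes, the column with one crossing merges with the column of two crossings, and
    leaves two columns of 2 and 3 half twists of opposite signs. *)
Lemma unknotted_absorb e a b :
  (a = 2 * sgn e /\ b = 3 * sgn e \/ a = 3 * sgn e /\ b = 2 * sgn e)%R ->
  unknotted (pretzel [:: sgn (~~ e); a; b]).
Proof.
have swapl c1 x c2 : same_pretzel (c1 ++ sgn (~~ e) :: x :: c2) (c1 ++ x :: sgn (~~ e) :: c2).
  exact: same_pretzel_sym (swap_unit _ _ _ _).
case=> [] [-> ->]; apply: unknotted_same (swapl [::] _ _) _ => //=.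
  apply: unknotted_same (@absorb_unit [::] e [:: _]) _ => //=.
  by apply: unknotted_two; case: e {swapl}.
apply: unknotted_same (swapl [:: _] _ [::]) _ => //=.
apply: unknotted_same (@absorb_unit [:: _] e [::]) _ => //=.
by apply: unknotted_two; case: e {swapl}.
Qed.

(** * The bracket of a pretzel link *)

Import Order.TTheory GRing.Theory Num.Theory.
Local Open Scope ring_scope.

Section Lists.
Local Open Scope nat_scope.
Variables (T : eqType).
Implicit Types (l : seq T) (x y : T).

Lemma size_insert2 i x y l : i <= size l -> size (insert2 i x y l) = (size l).+2.
Proof. by move=> il; rewrite size_cat /= size_drop size_takel // !addnS subnKC. Qed.

Lemma size_delete2 i l : i + 2 <= size l -> size (delete2 i l) = size l - 2.
Proof.
by move=> il; rewrite size_cat size_drop size_takel; lia.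
Qed.

Lemma mem_insert2 i x l z : z \in insert2 i x x l -> z = x \/ z \in l.
Proof.
rewrite mem_cat !inE => /or4P[/mem_take|/eqP|/eqP|/mem_drop]; auto.
Qed.

Lemma mem_delete2 i l z : z \in delete2 i l -> z \in l.
Proof. by rewrite mem_cat => /orP[/mem_take|/mem_drop]. Qed.
End Lists.

Lemma map_insert2 (T U : Type) (g : T -> U) i x y l :
  map g (insert2 i x y l) = insert2 i (g x) (g y) (map g l).
Proof. by rewrite /insert2 map_cat /= map_take map_drop. Qed.

Lemma map_delete2 (T U : Type) (g : T -> U) i l :
  map g (delete2 i l) = delete2 i (map g l).
Proof. by rewrite /delete2 map_cat map_take map_drop. Qed.

Section StateSum.
Variables (F : fieldType) (A d : F).
Hypotheses (A0 : A != 0) (dE : d = - A ^+ 2 - A ^- 2) (d0 : d != 0).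

(** The bracket, not normalized, of the part of a diagram that lies below strands named
    by l, where f is a fresh name and a circle has value d.  Only A != 0, d != 0 and
    d = - A^2 - A^-2 matter, so A and d live in an arbitrary field. *)
Definition state_sum (f : nat) (l : seq nat) (w : diagram) : F :=
  \sum_(s <- states w) A ^ s.1 * d ^+ components_from f l s.2.

(** The renaming that a Cup performs: y becomes x. *)
Definition rename (x y z : nat) : nat := if z == y then x else z.

Lemma state_sum_nil f l : state_sum f l [::] = 1.
Proof. by rewrite /state_sum big_seq1 mulr1. Qed.

Lemma state_sum_cap f l i w :
  state_sum f l ((Cap, i) :: w) = state_sum f.+1 (insert2 i f f l) w.
Proof. by rewrite /state_sum big_map. Qed.

Lemma state_sum_cup f l i w :
  state_sum f l ((Cup, i) :: w) =
  d ^+ (nth 0%N l i == nth 0%N l i.+1) *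
  state_sum f (map (rename (nth 0%N l i) (nth 0%N l i.+1)) (delete2 i l)) w.
Proof.
rewrite /state_sum big_map big_distrr; apply: eq_bigr => s _ /=.
by rewrite exprD mulrCA.
Qed.

Lemma state_sum_cross f l e i w :
  state_sum f l ((Cross e, i) :: w) =
  A ^ (sgn e) * state_sum f l w +
  A ^ (- sgn e) * state_sum f l [:: (Cup, i), (Cap, i) & w].
Proof.
rewrite /state_sum [states _]/= big_cat !big_map !big_distrr; congr (_ + _).
all: by apply: eq_bigr => s _; rewrite [LHS]/= expfzDr ?A0 // -mulrA.
Qed.

Definition bounded (f : nat) (l : seq nat) : Prop := forall z, z \in l -> (z < f)%N.

(** Names matter only through their equalities.  Stated for a single word so that the
    induction can use it for the Cup and the Cap that smooth a crossing. *)
Definition relabelable (w : diagram) : Prop :=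
  forall f f' (l : seq nat) (g : nat -> nat), fits (size l) w -> {in l &, injective g} ->
    bounded f l -> bounded f' (map g l) ->
    state_sum f l w = state_sum f' (map g l) w.

Lemma relabel_cap i w : relabelable w -> relabelable ((Cap, i) :: w).
Proof.
move=> IH f f' l g /= /andP[il fw] gi lf lf'.
rewrite addn0 in il; rewrite !state_sum_cap.
pose g' z := if z == f then f' else g z.
have g'f : g' f = f' by rewrite /g' eqxx.
have gE : {in l, g' =1 g}.
  by move=> z zl; rewrite /g' ifN //; apply/eqP=> e; have := lf z zl; rewrite e ltnn.
have -> : insert2 i f' f' (map g l) = map g' (insert2 i f f l).
  have /eq_in_map gM := gE.
  by rewrite map_insert2 gM /g' eqxx.
have gf' z : z \in l -> g z != f'.
  by move=> zl; apply/eqP=> e; have := lf' (g z) (map_f g zl); rewrite e ltnn.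
apply: IH.
- by rewrite size_insert2 // -addn2 -(subn0 (size l)).
- move=> z z' /mem_insert2[->|zl] /mem_insert2[->|zl'] //.
  + by rewrite g'f (gE _ zl') => e; have := gf' _ zl'; rewrite -e eqxx.
  + by rewrite g'f (gE _ zl) => e; have := gf' _ zl; rewrite e eqxx.
  by rewrite !gE //; apply: gi.
- by move=> z /mem_insert2[->|/lf /ltnW].
- move=> _ /mapP[z /mem_insert2[->|zl] ->]; first by rewrite /g' eqxx.
  by rewrite gE //; apply: ltnW; apply: lf'; apply: map_f.
Qed.

Lemma relabel_cup i w : relabelable w -> relabelable ((Cup, i) :: w).
Proof.
move=> IH f f' l g /= /andP[il fw] gi lf lf'.
have il1 : (i < size l)%N by lia. have il2 : (i.+1 < size l)%N by lia.
have xl : nth 0%N l i \in l by apply: mem_nth.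
have yl : nth 0%N l i.+1 \in l by apply: mem_nth.
rewrite !state_sum_cup !(nth_map 0%N) ?(inj_in_eq gi) //.
set x := nth 0%N l i in xl *; set y := nth 0%N l i.+1 in yl *.
congr (_ * _).
have rl z : z \in delete2 i l -> rename x y z \in l.
  by rewrite /rename => /mem_delete2; case: ifP.
have -> : map (rename (g x) (g y)) (delete2 i (map g l)) = map g (map (rename x y) (delete2 i l)).
  rewrite -map_delete2 -!map_comp; apply/eq_in_map => z /mem_delete2 zl /=.
  by rewrite /rename (inj_in_eq gi) //; case: ifP.
apply: IH.
- by rewrite size_map size_delete2 // -(addn0 (size l - 2)%N).
- by move=> _ _ /mapP[z zl ->] /mapP[z' zl' ->]; apply: gi; apply: rl.
- by move=> _ /mapP[z zl ->]; apply/lf/rl.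
- by move=> _ /mapP[_ /mapP[z zl ->] ->]; apply/lf'/map_f/rl.
Qed.

Lemma relabel w : relabelable w.
Proof.
elim: w => [|[[| |e] i] w IH]; [|exact: relabel_cap|exact: relabel_cup|].
  by move=> *; rewrite !state_sum_nil.
move=> f f' l g /= /andP[il fw] gi lf lf'; rewrite !state_sum_cross.
have e2 : (size l - 2 + 2 = size l)%N by lia.
rewrite e2 in fw; rewrite (IH f f' l g) //.
rewrite (relabel_cup (relabel_cap IH) _ gi lf lf') //=.
by rewrite il !addn0 subn0 e2 fw; lia.
Qed.

(** ** Expanding a column *)

Lemma state_sum_eq f f' l l' (g : nat -> nat) w : map g l = l' ->
  fits (size l) w -> {in l &, injective g} -> bounded f l -> bounded f' l' ->
  state_sum f l w = state_sum f' l' w.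
Proof. by move=> <-; apply: relabel. Qed.

Lemma take_insert2 i x y (l : seq nat) : (i <= size l)%N -> take i (insert2 i x y l) = take i l.
Proof. by move=> il; rewrite /insert2 take_cat size_takel // ltnn subnn take0 cats0. Qed.

Lemma drop_insert2 i x y (l : seq nat) : (i <= size l)%N -> drop i (insert2 i x y l) = [:: x, y & drop i l].
Proof. by move=> il; rewrite /insert2 drop_cat size_takel // ltnn subnn drop0. Qed.

Lemma delete2_insert2 i x y (l : seq nat) : (i <= size l)%N -> delete2 i (insert2 i x y l) = l.
Proof.
move=> il; rewrite /delete2 take_insert2 // -[i.+2]add2n -drop_drop drop_insert2 //.
by rewrite /= drop0 cat_take_drop.
Qed.

Lemma nth_insert2 i x y (l : seq nat) : (i <= size l)%N ->
  nth 0%N (insert2 i x y l) i = x /\ nth 0%N (insert2 i x y l) i.+1 = y.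
Proof.
move=> il; rewrite /insert2 !nth_cat size_takel // ltnn subnn ltnNge leqnSn /=.
by rewrite subSnn.
Qed.

(** Between two flat tangles on the same strands there is a circle. *)
Lemma state_sum_flat_flat f l i w :
  (i + 2 <= size l)%N -> bounded f l -> fits (size l) w ->
  state_sum f l [:: (Cup, i), (Cap, i), (Cup, i), (Cap, i) & w] =
  d * state_sum f l [:: (Cup, i), (Cap, i) & w].
Proof.
move=> il lf fw; rewrite !state_sum_cup !state_sum_cap state_sum_cup state_sum_cap.
set l1 := map _ _; have sl1 : size l1 = (size l - 2)%N by rewrite size_map size_delete2.
have il1 : (i <= size l1)%N by lia. have il2 : (i < size l)%N by lia.
have [-> ->] := nth_insert2 f f il1; rewrite eqxx expr1 delete2_insert2 // mulrCA.
congr (_ * (_ * _)); have -> : map (rename f f) l1 = l1.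
  by rewrite -[RHS]map_id; apply: eq_map => z; rewrite /rename; case: eqP.
have l1f : bounded f l1.
  move=> _ /mapP[z /mem_delete2 zl ->]; apply: lf; rewrite /rename; case: ifP => // _.
  exact: mem_nth.
pose g z := if z == f then f.+1 else z.
have gE z : z \in l1 -> g z = z by rewrite /g => /l1f; case: eqP => // ->; rewrite ltnn.
apply/esym; apply: (@state_sum_eq _ _ _ _ g).
- have /eq_in_map gM : {in l1, g =1 id} by [].
  by rewrite map_insert2 gM map_id /g eqxx.
- by rewrite size_insert2 // sl1; have -> : (size l - 2).+2 = size l by lia.
- move=> z z' /mem_insert2[->|zl] /mem_insert2[->|zl'] //.
  + by rewrite (gE _ zl') {1}/g eqxx => e; have := l1f _ zl'; rewrite -e; lia.
  + by rewrite (gE _ zl) {1}/g eqxx => e; have := l1f _ zl; rewrite e; lia.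
  by rewrite !gE.
- by move=> z /mem_insert2[->|/l1f]; lia.
- by move=> z /mem_insert2[->|/l1f]; lia.
Qed.

(** The coefficient of the flat tangle in a column of c half twists.  The operator that
    adds a crossing, applied to the flat tangle and to the empty column, has
    eigenvalues - A^-3 and A. *)
Definition twist_flat (c : int) : F := ((- A ^ (-3)) ^ c - A ^ c) / d.

Lemma twist_eigenvalue e : A ^ (sgn e) + A ^ (- sgn e) * d = (- A ^ (-3)) ^ (sgn e).
Proof.
rewrite dE; case: e; rewrite /= /exprz /=; field.
all: by rewrite ?oppr_eq0 ?A0 ?oner_neq0 ?expf_neq0.
Qed.

Lemma state_sum_flat_cross f l i e w :
  state_sum f l [:: (Cup, i), (Cap, i), (Cross e, i) & w] =
  A ^ (sgn e) * state_sum f l [:: (Cup, i), (Cap, i) & w] +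
  A ^ (- sgn e) * state_sum f l [:: (Cup, i), (Cap, i), (Cup, i), (Cap, i) & w].
Proof.
rewrite !(state_sum_cup f l) !(state_sum_cap f) (state_sum_cross _ _ e) mulrDr.
by rewrite !(mulrCA (d ^+ _)).
Qed.

Lemma state_sum_flat_twist f l i m e w :
  (i + 2 <= size l)%N -> bounded f l -> fits (size l) w ->
  state_sum f l [:: (Cup, i), (Cap, i) & twist i (nseq m e) ++ w] =
  (- A ^ (-3)) ^ (sgn e * m%:Z) * state_sum f l [:: (Cup, i), (Cap, i) & w].
Proof.
move=> il lf fw; elim: m => [|m IH]; first by rewrite mulr0 mul1r.
have [ft wt] := @fits_twist (size l) i (nseq m e) ltac:(lia).
rewrite [nseq _ _]/= [twist _ _]/= state_sum_flat_cross.
rewrite state_sum_flat_flat //; last by rewrite fits_cat ft wt.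
rewrite IH !mulrA -!mulrDl twist_eigenvalue -expfzDr; last first.
  by rewrite oppr_eq0 expfz_neq0 // A0.
by congr (_ ^ _ * _); lia.
Qed.

(** By induction on the number of crossings, using that the crossings below a flat tangle
    are kinks, which only multiply the bracket by powers of - A^-3. *)
Lemma state_sum_twist f l i m e w :
  (i + 2 <= size l)%N -> bounded f l -> fits (size l) w ->
  state_sum f l (twist i (nseq m e) ++ w) =
  A ^ (sgn e * m%:Z) * state_sum f l w +
  twist_flat (sgn e * m%:Z) * state_sum f l [:: (Cup, i), (Cap, i) & w].
Proof.
move=> il lf fw; elim: m => [|m IH].
  by rewrite /twist_flat mulr0 !expr0z subrr mul0r mul0r addr0 mul1r.
rewrite [twist _ _ ++ _]/= state_sum_cross IH state_sum_flat_twist //.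
set S := state_sum f l w; set H := state_sum f l _.
have E := twist_eigenvalue e.
have X0 : - A ^ (-3) != 0 by rewrite oppr_eq0 expfz_neq0.
have -> : sgn e * m.+1%:Z = sgn e + sgn e * m%:Z by lia.
rewrite /twist_flat !expfzDr // -E.
have -> : A ^ (- sgn e) = (A ^ sgn e)^-1 by rewrite invr_expz.
have a0 : A ^ sgn e != 0 by rewrite expfz_neq0.
by field; rewrite a0 d0.
Qed.

(** ** Moving a Cup upwards *)

(** The word w acts to the right of four strands a, b, c, e, of which the Cup that follows
    w joins the middle two.  If one of the names b and c, called u, is not the name
    of any further strand, that Cup can be executed before w: w never renames u, and
    the Cup amounts to renaming u. *)
Definition delayable (v w : diagram) : Prop :=
  forall (f a b c e : nat) (R : seq nat) (u t : nat),
    (b = t /\ c = u \/ b = u /\ c = t) -> u \notin R -> (u < f)%N ->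
    bounded f [:: a, b, c, e & R] -> fits (size R) w ->
    fits (width (size R) w + 2) v ->
    state_sum f [:: a, b, c, e & R] (shift 4 w ++ (Cup, 1%N) :: v) =
    d ^+ (b == c) * state_sum f (map (rename t u) [:: a, e & R]) (shift 2 w ++ v).

Lemma renameK (u t z : nat) : rename t u (rename u t z) = rename t u z.
Proof.
rewrite /rename; have [->|//] := eqVneq z t.
by rewrite eqxx; case: ifP.
Qed.

(** The Cup renames c to b; when it is b that is private, renaming b to c instead gives
    lists that differ by a relabeling. *)
Lemma delay_nil v : delayable v [::].
Proof.
move=> f a b c e R u t bc uR uf lf _ fv; rewrite /= in fv *.
rewrite state_sum_cup [nth _ _ _]/= [nth _ _ 2]/=.
have -> : delete2 1 [:: a, b, c, e & R] = [:: a, e & R] by [].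
case: bc lf => [] [-> ->] lf //; congr (_ * _).
apply: (@state_sum_eq _ _ _ _ (rename t u)).
- by rewrite /= !renameK -map_comp; congr [:: _, _ & _]; apply: eq_map => z /=; apply: renameK.
- by rewrite /= size_map -addn2.
- have nt z : rename u t z != t \/ u = t.
    by rewrite /rename; case: (eqVneq z t) => [_|]; [case: (eqVneq u t); auto|auto].
  move=> _ _ /(@mapP _ _ _ [:: a, e & R])[z _ ->] /(@mapP _ _ _ [:: a, e & R])[z' _ ->].
  have rr p : rename p p =1 id by move=> q; rewrite /rename; case: eqP => // ->.
  have [zt|->] := nt z; last by rewrite !rr.
  have [zt'|->] := nt z'; last by rewrite !rr.
  move: (rename u t z) (rename u t z') zt zt' => p q /eqP pt /eqP qt.
  by rewrite /rename; repeat case: eqP => ?; congruence.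
- move=> _ /(@mapP _ _ _ [:: a, e & R])[z zl ->]; rewrite /rename; case: ifP => // _.
  by apply: lf; move: zl; rewrite !inE => /or3P[]->; rewrite ?orbT.
move=> _ /(@mapP _ _ _ [:: a, e & R])[z zl ->]; rewrite /rename; case: ifP => // _.
  by apply: lf; rewrite !inE eqxx ?orbT.
by apply: lf; move: zl; rewrite !inE => /or3P[]->; rewrite ?orbT.
Qed.

Lemma delay_cap v i w : delayable v w -> delayable v ((Cap, i) :: w).
Proof.
move=> IH f a b c e R u t bc uR uf lf /= /andP[iR fw] fv.
rewrite addn0 in iR; rewrite !state_sum_cap.
have -> : insert2 (4 + i) f f [:: a, b, c, e & R] = [:: a, b, c, e & insert2 i f f R] by [].
have sR : size (insert2 i f f R) = (size R - 0 + 2)%N by rewrite size_insert2 // subn0 addn2.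
rewrite (IH _ _ _ _ _ _ u t) ?sR //; last 3 first.
- by apply/negP => /mem_insert2[ef|]; [move: uf; rewrite ef ltnn | apply/negP].
- exact: ltnW.
- move=> z; rewrite 4!inE => /or4P[/eqP->|/eqP->|/eqP->|/predU1P[->|/mem_insert2[->|zR]]] //; try (apply: ltnW; apply: lf; rewrite !inE ?eqxx ?orbT //).
  by rewrite zR !orbT.
congr (_ * state_sum _ _ _); rewrite map_cons map_cons map_insert2.
have -> : rename t u f = f by rewrite /rename ifN // gtn_eqF.
by [].
Qed.

Lemma delay_cup v i w : delayable v w -> delayable v ((Cup, i) :: w).
Proof.
move=> IH f a b c e R u t bc uR uf lf /= /andP[iR fw] fv.
have iR1 : (i < size R)%N by lia. have iR2 : (i.+1 < size R)%N by lia.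
rewrite !state_sum_cup.
have -> : delete2 (4 + i) [:: a, b, c, e & R] = [:: a, b, c, e & delete2 i R] by [].
have -> : delete2 (2 + i) [:: rename t u a, rename t u e & map (rename t u) R] =
   map (rename t u) [:: a, e & delete2 i R] by rewrite /= map_delete2.
rewrite [nth _ _ (4 + i)]/= [nth _ _ (4 + i).+1]/= [nth _ _ (2 + i)]/= [nth _ _ (2 + i).+1]/=.
rewrite !(nth_map 0%N) //.
have xR : nth 0%N R i \in R by apply: mem_nth.
have yR : nth 0%N R i.+1 \in R by apply: mem_nth.
set x := nth 0%N R i in xR *; set y := nth 0%N R i.+1 in yR *.
have [xu yu] : x != u /\ y != u by split; [apply: contraNneq uR => <- | apply: contraNneq uR => <-].
have rx z : z != u -> rename t u z = z by rewrite /rename => /negPf->.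
rewrite !rx //; set r := rename x y.
have ru : r u = u by rewrite /r /rename eq_sym (negPf yu).
have rR z : z \in R -> r z \in R by rewrite /r /rename; case: ifP.
have rNu z : z != u -> r z != u by rewrite /r /rename; case: ifP.
have rlf z : z \in [:: a, b, c, e & R] -> (r z < f)%N.
  by move=> zl; apply: lf; rewrite /r /rename; case: ifP => // _; rewrite !inE xR !orbT.
rewrite (IH f (r a) (r b) (r c) (r e) _ u (r t)) ?size_map ?size_delete2 //; last 5 first.
- by case: bc => [] [-> ->]; [left|right]; rewrite ?ru.
- apply/mapP => -[z /mem_delete2 zR eu]; have := rR z zR; rewrite -eu; exact/negP.
- move=> z; rewrite 4!inE => /or4P[/eqP->|/eqP->|/eqP->|/predU1P[->|/mapP[z' /mem_delete2 zR ->]]]; apply: rlf; rewrite !inE ?eqxx ?orbT //.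
  by rewrite zR !orbT.
- by rewrite -(addn0 (size R - 2)%N).
- by rewrite -(addn0 (size R - 2)%N).
have -> : (r b == r c) = (b == c).
  case: bc => [] [-> ->]; rewrite ru; have [->|tu] := eqVneq t u; rewrite ?ru ?eqxx //.
    exact: negPf (rNu _ tu).
  by rewrite eq_sym; exact: negPf (rNu _ tu).
rewrite mulrCA; congr (_ * (_ * state_sum _ _ _)).
rewrite -map_cons -map_cons -!map_comp; apply: eq_map => z /=.
rewrite -/(r _) -/(r _).
have re p : rename p u u = p by rewrite /rename eqxx.
have rn p q : q != u -> rename p u q = q by rewrite /rename => /negPf->.
by have [->|zu] := eqVneq z u; rewrite ?ru ?re // !rn // rNu.
Qed.

Lemma delay v w : delayable v w.
Proof.
elim: w => [|[[| |s] i] w IH]; [exact: delay_nil|exact: delay_cap|exact: delay_cup|].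
move=> f a b c e R u t bc uR uf lf /= /andP[iR fw] fv; rewrite !state_sum_cross.
have e2 : (size R - 2 + 2 = size R)%N by lia.
rewrite e2 in fw fv; rewrite (IH _ _ _ _ _ _ u t) //.
have := @delay_cup v i _ (@delay_cap v i w IH) f a b c e R u t bc uR uf lf.
have f1 : fits (size R) [:: (Cup, i), (Cap, i) & w] && fits (width (size R) [:: (Cup, i), (Cap, i) & w] + 2) v.
  by rewrite /= iR !addn0 subn0 e2 fw fv; lia.
have [f2 f3] := andP f1; move=> /(_ f2 f3) /= ->.
by rewrite mulrDr !(mulrCA (d ^+ _)).
Qed.

(** ** Fusing two columns *)

Lemma rename_fresh f (l : seq nat) x : bounded f l -> map (rename x f) l = l.
Proof.
move=> lf; rewrite -[RHS]map_id; apply/eq_in_map => z /lf; rewrite /rename.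
by case: eqP => // ->; rewrite ltnn.
Qed.

Lemma state_sum_fresh f l w : fits (size l) w -> bounded f l ->
  state_sum f.+1 l w = state_sum f l w.
Proof.
move=> fw lf; apply: (@state_sum_eq _ _ _ _ id); rewrite ?map_id // => z /lf.
exact: leqW.
Qed.

(** Two adjacent columns, on the strands x, f and f, y, are replaced by one on the strands x
    and y; w stands for the columns to their right and v for the minima that follow
    the one between the two columns.  When both columns have no crossing a circle
    splits off; when one is flat the other one survives; when both are flat so is
    their sum. *)
Section Fuse.
Variables (f x y : nat) (R : seq nat) (w v : diagram).
Hypotheses (lf : bounded f [:: x, y & R]) (fw : fits (size R) w)
  (fv : fits (width (size R) w + 2) v).
Let l := [:: x, f, f, y & R].
Let W := shift 4 w ++ (Cup, 1%N) :: v.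
Let W' := shift 2 w ++ v.

Let xf : (x < f)%N. Proof. by apply: lf; rewrite mem_head. Qed.
Let yf : (y < f)%N. Proof. by apply: lf; rewrite !inE eqxx orbT. Qed.
Let Rf : bounded f R. Proof. by move=> z zR; apply: lf; rewrite !inE zR !orbT. Qed.
Let fNR : f \notin R. Proof. by apply/negP => /Rf; rewrite ltnn. Qed.

Lemma fits_fused : fits (size R).+2 W'.
Proof.
have [f2 w2] := fits_shift 2 0 fw; rewrite !addn0 add2n in f2 w2.
by rewrite fits_cat f2 w2 addnC.
Qed.

Lemma fits_fuse : fits (size R).+4 W.
Proof.
have [f2 w2] := fits_shift 4 0 fw; rewrite !addn0 in f2 w2.
rewrite fits_cat f2 w2 /=; have -> : (4 + width (size R) w - 2 + 0 = width (size R) w + 2)%N by lia.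
by rewrite fv; lia.
Qed.

Lemma fuse_id_id : state_sum f.+1 l W = d * state_sum f [:: x, y & R] W'.
Proof.
rewrite /W (@delay _ _ _ _ _ _ _ _ f f) //; last 2 first.
- by left.
- by move=> z; rewrite !inE => /or4P[/eqP->|/eqP->|/eqP->|/orP[/eqP->|/Rf]] //; lia.
rewrite eqxx expr1 -/W'; congr (_ * _).
have -> : map (rename f f) [:: x, y & R] = [:: x, y & R].
  by rewrite -[RHS]map_id; apply: eq_map => z; rewrite /rename; case: eqP.
by apply: state_sum_fresh => //; apply: fits_fused.
Qed.

Lemma fuse_id_flat : state_sum f.+1 l [:: (Cup, 2%N), (Cap, 2%N) & W] = state_sum f [:: x, y & R] W'.
Proof.
rewrite state_sum_cup state_sum_cap [nth _ _ _]/= [nth _ _ 3%N]/= gtn_eqF // mul1r.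
have -> : map (rename f y) (delete2 2 l) = [:: rename f y x, f & map (rename f y) R].
  by rewrite /l /delete2 /= drop0 [rename f y f]/rename gtn_eqF.
set R' := map _ R; have -> : insert2 2 f.+1 f.+1 [:: rename f y x, f & R'] = [:: rename f y x, f, f.+1, f.+1 & R'].
  by rewrite /insert2 /= take0 drop0.
have rf z : (z < f)%N -> (rename f y z < f.+1)%N by rewrite /rename; case: ifP => // _; exact: leqW.
have R'f : bounded f.+1 R' by move=> _ /mapP[z /Rf zf ->]; apply: rf.
rewrite /W (@delay _ _ _ _ _ _ _ _ f.+1 f) //; last 5 first.
- by left.
- by apply/negP => /R'f; rewrite ltnn.
- by have := rf _ xf; move=> xf' z; rewrite !inE => /or4P[/eqP->|/eqP->|/eqP->|/orP[/eqP->|/R'f]] //; lia.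
- by rewrite size_map.
- by rewrite size_map.
rewrite ltn_eqF // mul1r -/W' 2!map_cons (rename_fresh _ R'f).
rewrite [rename f f.+1 f.+1]/rename eqxx.
have -> : rename f f.+1 (rename f y x) = rename f y x.
  by rewrite {1}/rename ltn_eqF // rf.
apply/esym; apply: (@state_sum_eq _ _ _ _ (rename f y)).
- by rewrite /= [rename f y y]/rename eqxx.
- exact: fits_fused.
- move=> z z' /lf zf /lf zf'; rewrite /rename.
  by case: eqP => [->|_]; case: eqP => [->|_] //; lia.
- exact: lf.
by move=> z; rewrite !inE => /or3P[/eqP->|/eqP->|/R'f]; [have := rf _ xf | |]; lia.
Qed.

Lemma cut_first X : state_sum f.+1 l [:: (Cup, 0%N), (Cap, 0%N) & X] =
  state_sum f.+2 [:: f.+1, f.+1, x, y & R] X.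
Proof.
rewrite state_sum_cup state_sum_cap [nth _ _ _]/= [nth _ _ 1%N]/= ltn_eqF // mul1r.
rewrite [delete2 _ _]/= [map _ _]/= [rename x f f]/rename eqxx.
have -> : rename x f y = y by rewrite /rename ltn_eqF.
by rewrite [map _ _](rename_fresh _ Rf).
Qed.

Lemma fuse_flat_id : state_sum f.+1 l [:: (Cup, 0%N), (Cap, 0%N) & W] = state_sum f [:: x, y & R] W'.
Proof.
have R2 : bounded f.+2 R by move=> z /Rf; lia.
rewrite cut_first /W (@delay _ _ _ _ _ _ _ _ f.+1 x) //; last 3 first.
- by right.
- by apply/negP => /Rf; lia.
- by move=> z; rewrite !inE => /or4P[/eqP->|/eqP->|/eqP->|/orP[/eqP->|/Rf]] //; lia.
have -> : (f.+1 == x) = false by apply/eqP; lia.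
rewrite mul1r 2!map_cons [rename x f.+1 f.+1]/rename eqxx.
have -> : rename x f.+1 y = y by rewrite /rename; case: eqP => //; lia.
have R1 : bounded f.+1 R by move=> z /Rf; lia.
rewrite rename_fresh // !state_sum_fresh //; try exact: fits_fused.
by move=> z /lf; lia.
Qed.

Lemma fuse_flat_flat :
  state_sum f.+1 l [:: (Cup, 0%N), (Cap, 0%N), (Cup, 2%N), (Cap, 2%N) & W] =
  state_sum f [:: x, y & R] [:: (Cup, 0%N), (Cap, 0%N) & W'].
Proof.
rewrite cut_first !state_sum_cup !state_sum_cap.
rewrite [nth _ [:: f.+1, _ & _] _]/= [nth _ [:: f.+1, _ & _] _]/=.
rewrite [nth _ _ 0%N]/= [nth _ _ 1%N]/=; congr (_ * _).
have -> : delete2 2 [:: f.+1, f.+1, x, y & R] = [:: f.+1, f.+1 & R].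
  by rewrite /delete2 /= drop0.
have -> : delete2 0 [:: x, y & R] = R by rewrite /delete2 /= drop0.
rewrite 2!map_cons; set R' := map (rename x y) R.
have -> : rename x y f.+1 = f.+1 by rewrite /rename; case: eqP => //; lia.
have R'f : bounded f R' by move=> _ /mapP[z /Rf zf ->]; rewrite /rename; case: ifP.
have -> : insert2 2 f.+2 f.+2 [:: f.+1, f.+1 & R'] = [:: f.+1, f.+1, f.+2, f.+2 & R'].
  by rewrite /insert2 /= take0 drop0.
have -> : insert2 0 f f R' = [:: f, f & R'] by rewrite /insert2 take0 drop0.
have R2 : bounded f.+2 R' by move=> z /R'f; lia.
rewrite /W (@delay _ _ _ _ _ _ _ _ f.+2 f.+1) ?size_map //; last 3 first.
- by left.
- by apply/negP => /R'f; lia.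
- by move=> z; rewrite !inE => /or4P[/eqP->|/eqP->|/eqP->|/orP[/eqP->|/R'f]] //; lia.
rewrite ltn_eqF // mul1r 2!map_cons rename_fresh //.
have -> : rename f.+1 f.+2 f.+1 = f.+1 by rewrite /rename; case: eqP => //; lia.
rewrite [rename f.+1 f.+2 f.+2]/rename eqxx.
have gE z : z \in R' -> rename f.+1 f z = z.
  by move=> /R'f zf; rewrite /rename; case: eqP => //; lia.
apply/esym; apply: (@state_sum_eq _ _ _ _ (rename f.+1 f)).
- rewrite /= [rename f.+1 f f]/rename eqxx; congr [:: _, _ & _].
  by rewrite -[RHS]map_id; apply/eq_in_map.
- by rewrite /= size_map; apply: fits_fused.
- have H z : z \in [:: f, f & R'] -> (z <= f)%N by rewrite !inE => /or3P[/eqP->|/eqP->|/R'f/ltnW].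
  by move=> z z' /H zf /H zf'; rewrite /rename; do 2 case: eqP => ?; lia.
- by move=> z; rewrite !inE => /or3P[/eqP->|/eqP->|/R'f]; lia.
by move=> z; rewrite !inE => /or3P[/eqP->|/eqP->|/R'f]; lia.
Qed.

(** Here a and b are the coefficients of the empty and of the flat tangle in the
    left-hand column. *)
Lemma fuse a b m e (c := sgn e * m%:Z) :
  a * state_sum f.+1 l (twist 2 (nseq m e) ++ W) +
  b * state_sum f.+1 l [:: (Cup, 0%N), (Cap, 0%N) & twist 2 (nseq m e) ++ W] =
  (d * a * A ^ c + a * twist_flat c + b * A ^ c) * state_sum f [:: x, y & R] W' +
  (b * twist_flat c) * state_sum f [:: x, y & R] [:: (Cup, 0%N), (Cap, 0%N) & W'].
Proof.
have lf1 : bounded f.+1 l.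
  by move=> z; rewrite !inE => /or4P[/eqP->|/eqP->|/eqP->|/orP[/eqP->|/Rf]] //; lia.
have lf2 : bounded f.+2 [:: f.+1, f.+1, x, y & R].
  by move=> z; rewrite !inE => /or4P[/eqP->|/eqP->|/eqP->|/orP[/eqP->|/Rf]] //; lia.
rewrite cut_first !state_sum_twist //; try exact: fits_fuse.
rewrite -!cut_first fuse_id_id fuse_id_flat fuse_flat_id fuse_flat_flat -/c.
ring.
Qed.
End Fuse.

(** ** Fusing all columns *)

(** The names of the strands below the maxima of a pretzel diagram with k + 1 columns. *)
Fixpoint arcs (k : nat) : seq nat :=
  if k is k'.+1 then insert2 1 k k (arcs k') else [:: 0; 0]%N.

Lemma arcs_spec k : exists x y R,
  [/\ arcs k = [:: x, y & R], size R = k.*2 & bounded k.+1 (arcs k)].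
Proof.
elim: k => [|k [x [y [R [e sR lf]]]]].
  by exists 0%N, 0%N, [::]; split=> // z; rewrite !inE => /orP[/eqP->|/eqP->].
exists x, k.+1, [:: k.+1, y & R]; split; rewrite /= ?e ?sR //.
move=> z; rewrite e in lf; rewrite !inE => /or4P[/eqP->|/eqP->|/eqP->|/orP[/eqP->|zR]] //.
- by have := lf x (mem_head _ _); lia.
- by have := lf y; rewrite !inE eqxx orbT => /(_ isT); lia.
by have := lf z; rewrite !inE zR !orbT => /(_ isT); lia.
Qed.

Lemma state_sum_caps k w :
  state_sum 0 [::] ((Cap, 0%N) :: nseq k (Cap, 1%N) ++ w) = state_sum k.+1 (arcs k) w.
Proof.
elim: k w => [|k IH] w; first by rewrite state_sum_cap.
by rewrite nseq_rcons -catA IH state_sum_cap.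
Qed.

Definition bottom (k : nat) : diagram := rcons (nseq k (Cup, 1%N)) (Cup, 0%N).

(** The columns on the left have been fused into one, with coefficients a and b; the entries
    of c are the columns still to be fused. *)
Definition block_sum (a b : F) (c : seq int) (w := row 2 (map column c) ++ bottom (size c)) : F :=
  a * state_sum (size c).+1 (arcs (size c)) w +
  b * state_sum (size c).+1 (arcs (size c)) [:: (Cup, 0%N), (Cap, 0%N) & w].

Lemma block_sum_cons a b x c : block_sum a b (x :: c) =
  block_sum (d * a * A ^ x + a * twist_flat x + b * A ^ x) (b * twist_flat x) c.
Proof.
have xE : x = sgn (0 < x) * `|x|%N%:Z by case: x => [[|m]|m] //; rewrite /sgn /=; lia.
have [y [z [R [eR sR lf]]]] := arcs_spec (size c).
have bc := blocks_columns c.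
have [f0 w0] := @fits_row (size R) 0 (map column c) bc ltac:(rewrite size_map sR; lia).
have [f1 w1] := fits_close (size c).
have fv : fits (width (size R) (row 0 (map column c)) + 2) (bottom (size c)).
  by rewrite w0 sR; have -> : ((size c).*2 + 2 = (size c).+1.*2)%N by lia.
rewrite eR in lf; have := @fuse _ _ _ _ _ _ lf f0 fv a b `|x|%N (0 < x).
rewrite -xE !shift_row -eR /block_sum => <-.
have -> : row 2 (map column (x :: c)) ++ bottom (size (x :: c)) =
   twist 2 (nseq `|x|%N (0 < x)) ++ row 4 (map column c) ++ (Cup, 1%N) :: bottom (size c).
  by rewrite /= shift_twist -catA.
by rewrite [size _]/= [arcs _]/= eR.
Qed.

Lemma block_sum_nil a b : block_sum a b [::] = a * d + b * d ^+ 2.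
Proof.
rewrite /block_sum [row _ _ ++ _]/= !state_sum_cup !state_sum_cap !state_sum_cup !state_sum_nil /=.
by rewrite !mulr1 expr1 expr2.
Qed.

(** Fusing multiplies the quantities d a + b and b of the columns, and closing a single
    column gives d a + d^2 b. *)
Lemma block_sumE a b c : block_sum a b c =
  (d * a + b) * \prod_(x <- c) (d * A ^ x + twist_flat x) +
  (d ^+ 2 - 1) * (b * \prod_(x <- c) twist_flat x).
Proof.
elim: c a b => [|x c IH] a b; first by rewrite block_sum_nil !big_nil; ring.
by rewrite block_sum_cons IH !big_cons; ring.
Qed.

(** The first column plays the role of the fused one in block_sum. *)
Lemma pretzel_state_sum c : c != [::] ->
  state_sum 0 [::] (pretzel c) =
  \prod_(x <- c) (d * A ^ x + twist_flat x) + (d ^+ 2 - 1) * \prod_(x <- c) twist_flat x.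
Proof.
case: c => // x c _; have := block_sumE (A ^ x) (twist_flat x) c; rewrite !big_cons => <-.
have xE : x = sgn (0 < x) * `|x|%N%:Z by case: x => [[|m]|m] //; rewrite /sgn /=; lia.
have [y [z [R [eR sR lf]]]] := arcs_spec (size c).
have bc := blocks_columns c.
have [f0 w0] := @fits_row (size R).+2 2%N (map column c) bc ltac:(by rewrite size_map sR addnC addn2).
have [f1 w1] := fits_close (size c).
rewrite pretzelE /necklace [size _]/= size_map state_sum_caps.
rewrite [row _ _]/= shift0 -catA {1}/column state_sum_twist -?xE //.
- by rewrite eR.
by rewrite eR fits_cat f0 w0 sR.
Qed.

(** ** Normalizing the state sum *)

Lemma perm_delete2 i (l : seq nat) : (i + 2 <= size l)%N ->
  perm_eq l [:: nth 0%N l i, nth 0%N l i.+1 & delete2 i l].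
Proof.
move=> il; have i1 : (i < size l)%N by lia. have i2 : (i.+1 < size l)%N by lia.
rewrite -{1}(cat_take_drop i l) (drop_nth 0%N i1) (drop_nth 0%N i2).
rewrite /delete2 (perm_catCA (take i l) [:: _; _]) //.
Qed.

(** Every name occurs at least twice among the open strands, and merging two names
    preserves this; so strands remain until some Cup closes a component. *)
Lemma closed_components_gt0 f l w : l != [::] ->
  (forall z, z \in l -> (1 < count_mem z l)%N) -> closed_diagram_from (size l) w ->
  (0 < components_from f l w)%N.
Proof.
elim: w f l => [|[p i] w IH] f l l0 cl /=; first by rewrite size_eq0 (negPf l0).
case/andP; case: p => [|| e] /= il cw.
- rewrite addn0 in il; apply: IH; last by rewrite size_insert2 // -addn2 -(subn0 (size l)).
    by rewrite -size_eq0 size_insert2.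
  move=> z zl; have -> : count_mem z (insert2 i f f l) = ((f == z) + ((f == z) + count_mem z l))%N.
    by rewrite /insert2 count_cat /= addnCA (addnCA (count _ _)) -count_cat cat_take_drop.
  have [_|fz] := eqVneq f z; first by [].
  by case: (mem_insert2 zl) fz => [->|/cl //]; rewrite eqxx.
- have [//|xy] := eqVneq; rewrite add0n.
  set x := nth 0%N l i in xy *; set y := nth 0%N l i.+1 in xy *.
  have pl := perm_delete2 il; rewrite -/x -/y in pl.
  have cE a : count a l = (a x + (a y + count a (delete2 i l)))%N by rewrite (permP pl).
  have xl : x \in l by rewrite (perm_mem pl) mem_head.
  have yl : y \in l by rewrite (perm_mem pl) !inE eqxx orbT.
  have cx := cl _ xl; have cy := cl _ yl.
  rewrite cE /= eqxx eq_sym (negPf xy) in cx; rewrite cE /= eqxx (negPf xy) in cy.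
  have cx' : (1 < count_mem x (map (rename x y) (delete2 i l)))%N.
    rewrite count_map; have /eq_count -> : preim (rename x y) (pred1 x) =1 predU (pred1 x) (pred1 y).
      by move=> z /=; rewrite /rename; case: (z =P y) => [->|]; rewrite ?eqxx ?orbT ?orbF.
    have := count_predUI (pred1 x) (pred1 y) (delete2 i l).
    have /eq_count -> : predI (pred1 x) (pred1 y) =1 pred0.
      by move=> z /=; case: eqP => // ->; rewrite (negPf xy).
    rewrite count_pred0 addn0 => ->; exact: (@leq_add 1 1 _ _ cx cy).
  apply: IH; last by rewrite size_map size_delete2 // -(addn0 (size l - 2)%N).
    by apply: contraTneq cx' => ->.
  move=> z; have [->|zx] := eqVneq z x => [//|/mapP[z' z'l ez]].
  have z'y : z' != y by apply: contraNneq zx => z'y; rewrite ez /rename z'y eqxx.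
  have ezz : z = z' by rewrite ez /rename (negPf z'y).
  rewrite count_map; have /eq_count -> : preim (rename x y) (pred1 z) =1 predD1 (pred1 z) y.
    move=> q /=; rewrite /rename; case: (q =P y) => //= _.
    by rewrite eq_sym (negPf zx).
  have /eq_count -> : predD1 (pred1 z) y =1 pred1 z.
    by move=> q /=; case: (q =P z) => [->|]; rewrite ?andbF // andbT ezz z'y.
  have xz : (x == z) = false by rewrite eq_sym (negPf zx).
  have yz : (y == z) = false by rewrite ezz eq_sym (negPf z'y).
  by have := cl z; rewrite cE /= xz yz !add0n; apply; rewrite ezz; apply: mem_delete2 z'l.
have ps : perm_eq (swap2 0%N i l) l.
  rewrite perm_sym; apply: perm_trans (perm_delete2 il) _; rewrite perm_sym.
  rewrite /swap2 /delete2 (perm_catCA (take i l) [:: _; _]) /=.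
  by apply/permP => a /=; rewrite addnCA.
have e2 : (size l - 2 + 2 = size l)%N by rewrite subnK // (leq_trans _ il) // leq_addl.
rewrite e2 in cw; apply: IH; rewrite ?(perm_size ps) //.
  by rewrite -size_eq0 (perm_size ps) size_eq0.
by move=> z; rewrite (perm_mem ps) (permP ps); apply: cl.
Qed.

Lemma states_closed k w : closed_diagram_from k w ->
  all (fun s => closed_diagram_from k s.2) (states w).
Proof.
elim: w k => [|[p i] w IH] k /=; first by rewrite andbT.
case/andP; case: p => [|| e] /= ik cw; rewrite ?all_cat !all_map.
- by apply: sub_all (IH _ cw) => s cs /=; rewrite ik.
- by apply: sub_all (IH _ cw) => s cs /=; rewrite ik.
have e2 : (k - 2 + 2 = k)%N by rewrite subnK // (leq_trans _ ik) // leq_addl.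
have ik' : (i <= k - 2)%N by rewrite leq_subRL ?(leq_trans _ ik) ?leq_addl // addnC.
rewrite e2 in cw; rewrite (sub_all _ (IH _ cw)) //=.
by apply: sub_all (IH _ cw) => s cs /=; rewrite ik !addn0 subn0 e2 cs ik'.
Qed.

(** The predecessor in the exponent of bracket is not truncated, because every state
    has a component. *)
Lemma state_sum_normalized w : closed_diagram ((Cap, 0%N) :: w) ->
  state_sum 0 [::] ((Cap, 0%N) :: w) =
  d * \sum_(s <- states ((Cap, 0%N) :: w)) A ^ s.1 * d ^+ (components s.2).-1.
Proof.
move=> cw; rewrite big_distrr /state_sum [states _]/= !big_map [LHS]/= [RHS]/=.
have /all_filterP <- := @states_closed 2 w cw; rewrite !big_filter; apply: eq_bigr => s cs.
have pos : (0 < components_from 1 [:: 0; 0]%N s.2)%N.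
  by apply: closed_components_gt0 => // z; rewrite !inE => /orP[]/eqP->.
by rewrite mulrCA -exprS prednK.
Qed.
End StateSum.

Lemma t4_neq0 : t4 != 0.
Proof. by rewrite /t4 tofrac_eq0 polyX_eq0. Qed.

Lemma t4_pow4 : t4 ^+ 4 + 1 != 0.
Proof.
rewrite /t4 -rmorphXn -(rmorph1 (@tofrac _)) -rmorphD tofrac_eq0.
by apply/eqP => /(congr1 (fun p : {poly int} => p.[0])); rewrite hornerD hornerXn hornerC hornerC.
Qed.

(** Up to a unit, the value of a circle is t^4 + 1. *)
Lemma loop_neq0 (F : fieldType) (t : F) : t != 0 -> t ^+ 4 + 1 != 0 ->
  - t^-1 ^+ 2 - t^-1 ^- 2 != 0.
Proof.
move=> t0 t1; have -> : - t^-1 ^+ 2 - t^-1 ^- 2 = - (t ^+ 4 + 1) / t ^+ 2.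
  by field; rewrite t0 oner_neq0.
by rewrite mulf_neq0 ?oppr_eq0 // invr_eq0 expf_neq0.
Qed.

Lemma delta_neq0 : delta != 0.
Proof. exact: loop_neq0 t4_neq0 t4_pow4. Qed.

Lemma varA_neq0 : varA != 0.
Proof. rewrite /varA invr_eq0; exact: t4_neq0. Qed.

Lemma pretzel_bracket c : c != [::] ->
  delta * bracket (pretzel c) =
  \prod_(x <- c) (delta * varA ^ x + twist_flat varA delta x) +
  (delta ^+ 2 - 1) * \prod_(x <- c) twist_flat varA delta x.
Proof.
move=> c0; rewrite -(pretzel_state_sum varA_neq0 erefl delta_neq0 c0).
apply/esym; apply: state_sum_normalized; [exact: varA_neq0 | exact: delta_neq0 |].
exact: (closed_pretzel c0).
Qed.

(** * The equations of a trivial bracket *)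

(** With u for the variable, polT is - u q.  Up to signed powers of u, the factors
    q + u^p and q + u^-n of the pretzel formula are polA p and polB n, and both
    u^m - 1 and u^-m - 1 are polC m. *)
Definition polT : {poly int} := 1 - 'X + 'X^2.
Definition polA (p : nat) : {poly int} := polT - 'X^(p.+1).
Definition polB (n : nat) : {poly int} := 1 - 'X^(n.-1) * polT.
Definition polC (m : nat) : {poly int} := 1 - 'X^m.

(** A power of the variable with exponent z of any sign is moved to the side of the equation
    where its exponent is positive. *)
Definition pos_part (z : int) : nat := if z is Posz m then m else 0.
Definition neg_part (z : int) : nat := if z is Negz m then m.+1 else 0.

Definition signed_power (k : nat) (f : {poly int}) : Prop :=
  exists s j, f = (-1) ^+ s * 'X^j * (1 - 'X) ^+ k.

(** The equation satisfied by a pretzel link with trivial bracket whose positive long columns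
    are ps and whose negative ones are - ns; z is the exponent 1 - e - size ps. *)
Definition trivial_eq (z : int) (ps ns : seq nat) : Prop :=
  signed_power (size ps + size ns).+1
    ('X^(pos_part z) * (\prod_(p <- ps) polA p * \prod_(n <- ns) polB n) -
     'X^(neg_part z) * (polT * (\prod_(p <- ps) polC p * \prod_(n <- ns) polC n))).

(** ** The two lowest coefficients *)

(** f = 1 - c X + terms of higher order. *)
Definition near1 (c : int) (f : {poly int}) : Prop := f`_0 = 1 /\ f`_1 = - c.

Lemma coef1M (f g : {poly int}) : (f * g)`_1 = f`_0 * g`_1 + f`_1 * g`_0.
Proof. by rewrite coefM !big_ord_recr big_ord0 /= add0r. Qed.

Lemma near1M c e f g : near1 c f -> near1 e g -> near1 (c + e) (f * g).
Proof. by case=> f0 f1 [g0 g1]; split; rewrite ?coef0M ?coef1M f0 g0 ?f1 ?g1; ring. Qed.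

Lemma near1_1 : near1 0 1.
Proof. by split; rewrite coef1. Qed.

Lemma near1_exp c f k : near1 c f -> near1 (c *+ k) (f ^+ k).
Proof.
by move=> nf; elim: k => [|k IH]; [exact: near1_1 | rewrite exprS mulrS; apply: near1M].
Qed.

Lemma near1_polT : near1 1 polT.
Proof. by split; rewrite /polT !coefE. Qed.

Lemma near1_polA p : (1 < p)%N -> near1 1 (polA p).
Proof. by case: p => [|[|p]] // _; split; rewrite /polA /polT !coefE. Qed.

Lemma near1_polB n : (1 < n)%N -> near1 (n == 2)%N%:Z (polB n).
Proof.
case: n => [|[|n]] // _; rewrite /polB /=; split; rewrite coefB coef1 coefXnM //.
by case: n => [|n] //; rewrite subnn /polT !coefE.
Qed.

Lemma near1_polC m : (1 < m)%N -> near1 0 (polC m).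
Proof. by case: m => [|[|m]] // _; split; rewrite /polC !coefE. Qed.

Lemma near1_1X k : near1 k%:Z ((1 - 'X) ^+ k).
Proof.
have -> : k%:Z = 1 *+ k by rewrite natz.
by apply: near1_exp; split; rewrite !coefE.
Qed.

Lemma signed_power_near k f : signed_power k f -> f`_0 != 0 -> f`_1 = - (f`_0 * k%:Z).
Proof.
move=> [s [j ->]]; have [h0 h1] := near1_1X k.
rewrite -mulrA; case: j => [|j]; last by rewrite coef0M exprS -!mulrA coefXM mulr0 eqxx.
rewrite mul1r -signr_odd; case: (odd s); rewrite ?mulN1r ?mul1r ?coefN h0 h1; lia.
Qed.

Lemma near1_prodA ps : all (ltn 1) ps -> near1 (size ps)%:Z (\prod_(p <- ps) polA p).
Proof.
elim: ps => [|p ps IH] /=; first by rewrite big_nil => _; exact: near1_1.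
by case/andP=> p2 /IH nA; rewrite big_cons intS; apply: near1M nA; apply: near1_polA.
Qed.

Lemma near1_prodB ns : all (ltn 1) ns ->
  near1 (count_mem 2%N ns)%:Z (\prod_(n <- ns) polB n).
Proof.
elim: ns => [|n ns IH] /=; first by rewrite big_nil => _; exact: near1_1.
by case/andP=> n2 /IH nB; rewrite big_cons PoszD; apply: near1M nB; apply: near1_polB.
Qed.

Lemma near1_prodC ms : all (ltn 1) ms -> near1 0 (\prod_(m <- ms) polC m).
Proof.
elim: ms => [|m ms IH] /=; first by rewrite big_nil => _; exact: near1_1.
by case/andP=> m2 /IH nC; rewrite big_cons -[0]addr0; apply: near1M nC; apply: near1_polC.
Qed.

(** The quotient of the two lowest coefficients of the right-hand side of the equation is minus
    the number of long columns, minus 1.  For z > 1 the left-hand side has the lowest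
    terms of - polT, for z = 1 it is - 1 + 2 X, and for z < 0 the coefficients come
    from the product of the polA and polB, with a correction - X for z = -1; there
    only a polB 2 matches the contribution of a negative column. *)
Lemma second_coefficient z ps ns (N := (size ps + size ns)%N) :
  all (ltn 1) ps -> all (ltn 1) ns -> trivial_eq z ps ns ->
  [/\ z < 2 \/ N = 0%N, z = 1 -> N = 1%N, z = -1 -> all (pred1 2%N) ns & -1 <= z].
Proof.
move=> ps2 ns2; rewrite /trivial_eq -/N.
set P := _ * \prod_(n <- ns) polB n; set Q := polT * _ => sp.
have nP : near1 (size ps + count_mem 2%N ns)%N%:Z P.
  by rewrite PoszD; apply: near1M; [apply: near1_prodA | apply: near1_prodB].
have nQ := near1M near1_polT (near1M (near1_prodC ps2) (near1_prodC ns2)).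
rewrite !addr0 -/Q in nQ; have [q0 q1] := nQ.
have [p0 p1] := nP.
have cs : (count_mem 2%N ns <= size ns)%N := count_size _ _.
have := signed_power_near sp; rewrite !coefB !coefXnM.
case: z sp => [[|[|z]]|[|z]] sp /=; rewrite ?subn0 ?subn1 ?p0 ?p1 ?q0 ?q1 => nk.
- by split=> //; left.
- split=> //; first by left.
  by move: (nk isT) => /=; rewrite ?p0 => nk' _; lia.
- by split=> //; right; move: (nk isT) => /=; lia.
- split=> //; first by left.
  by move: (nk isT) => /=; rewrite ?q0 all_count => nk' _; apply/eqP; lia.
- by exfalso; move: (nk isT); lia.
Qed.

(** ** The determinant *)

(** The quotients of polC, polA and polB by 1 - X.  Their values at 1 agree, and polA and polB
    differ from polC by monomials, whose derivatives at 1 are all that remains of the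
    equation in the lemmas on determinants. *)
Definition polc (m : nat) : {poly int} := \sum_(i < m) 'X^i.
Definition pola (p : nat) : {poly int} := polc p + 'X^p - 'X.
Definition polb (n : nat) : {poly int} := polc n + 'X^n - 'X^(n.-1).

Lemma polC_factor m : polC m = (1 - 'X) * polc m.
Proof. by rewrite /polC /polc -opprB subrX1 -mulNr opprB. Qed.

Lemma polA_factor p : polA p = (1 - 'X) * pola p.
Proof.
rewrite /pola mulrBr mulrDr -polC_factor /polA /polC /polT (exprSr _ p); ring.
Qed.

Lemma polB_factor n : (0 < n)%N -> polB n = (1 - 'X) * polb n.
Proof.
case: n => // n _; rewrite /polb mulrBr mulrDr -polC_factor /polB /polC /polT /= (exprSr _ n); ring.
Qed.

Lemma signed_power_factor k f : signed_power k.+1 ((1 - 'X) * f) -> signed_power k f.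
Proof.
move=> [s [j e]]; exists s, j; have X1 : 1 - 'X != 0 :> {poly int}.
  by rewrite -opprB oppr_eq0 polyXsubC_eq0.
by apply: (mulfI X1); rewrite e exprS; ring.
Qed.

Lemma horner_signed k s j (x : int) :
  ((-1) ^+ s * 'X^j * (1 - 'X) ^+ k : {poly int}).[x] = (-1) ^+ s * x ^+ j * (1 - x) ^+ k.
Proof.
have -> : (-1 : {poly int}) = (-1)%:P by rewrite polyCN.
by rewrite !hornerM !horner_exp hornerD hornerN hornerX !hornerC.
Qed.

(** The derivative at 1 kills everything but the derivative of 1 - X. *)
Lemma signed_power1_deriv f : signed_power 1 f -> `|f^`().[1]| = 1.
Proof.
move=> [s [j ->]]; rewrite expr1 derivM derivB derivC derivX sub0r hornerD mulrN1 hornerN.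
rewrite hornerM hornerD hornerN hornerX hornerC subrr mulr0 add0r.
have := horner_signed 0 s j 1; rewrite !mulr1 => ->.
by rewrite expr1n mulr1 !(normrN, normrX, normr1, expr1n).
Qed.

Lemma polc1 m : (polc m).[1] = m%:Z.
Proof.
rewrite /polc horner_sum (eq_bigr (fun=> 1)); last by move=> i _; rewrite hornerXn expr1n.
by rewrite sumr_const card_ord natz.
Qed.

Section AtOne.
Implicit Types f g : {poly int}.

Lemma at1D f g : (f + g).[1] = f.[1] + g.[1]. Proof. exact: hornerD. Qed.
Lemma at1B f g : (f - g).[1] = f.[1] - g.[1]. Proof. by rewrite hornerD hornerN. Qed.
Lemma at1M f g : (f * g).[1] = f.[1] * g.[1]. Proof. exact: hornerM. Qed.
Lemma at1Xn n : ('X^n : {poly int}).[1] = 1. Proof. by rewrite hornerXn expr1n. Qed.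
Lemma at1X : ('X : {poly int}).[1] = 1. Proof. exact: hornerX. Qed.
Lemma at1_1 : (1 : {poly int}).[1] = 1. Proof. exact: hornerC. Qed.
Lemma deriv1D f g : (f + g)^`().[1] = f^`().[1] + g^`().[1].
Proof. by rewrite derivD hornerD. Qed.
Lemma deriv1B f g : (f - g)^`().[1] = f^`().[1] - g^`().[1].
Proof. by rewrite derivB hornerD hornerN. Qed.
Lemma deriv1M f g : (f * g)^`().[1] = f^`().[1] * g.[1] + f.[1] * g^`().[1].
Proof. by rewrite derivM hornerD !hornerM. Qed.
Lemma deriv1Xn n : ('X^n : {poly int})^`().[1] = n%:Z.
Proof. by rewrite derivXn hornerMn hornerXn expr1n natz. Qed.
Lemma deriv1X : ('X : {poly int})^`().[1] = 1.
Proof. by rewrite derivX hornerC. Qed.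
Lemma deriv1_1 : (1 : {poly int})^`().[1] = 0.
Proof. by rewrite derivC horner0. Qed.
End AtOne.

Definition at1E := (at1B, at1D, at1M, at1Xn, at1X, at1_1,
  deriv1B, deriv1D, deriv1M, deriv1Xn, deriv1X, deriv1_1, polc1).

Lemma pos_neg_part z : (pos_part z)%:Z = z + (neg_part z)%:Z.
Proof. by case: z => [m|m]; rewrite /pos_part /neg_part; lia. Qed.

(** This and the next four lemmas say that the determinant is 1 up to sign, for each
    possible number and signs of the long columns. *)
Lemma det0 z : trivial_eq z [::] [::] -> `|z - 1| = 1.
Proof.
rewrite /trivial_eq /= !big_nil /polT => /signed_power1_deriv.
rewrite !at1E pos_neg_part => e; rewrite -[RHS]e; congr `|_|; ring.
Qed.

Lemma det1 z p : trivial_eq z [:: p] [::] -> `|p%:Z * z - 1| = 1.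
Proof.
rewrite /trivial_eq /= !big_seq1 !big_nil polA_factor polC_factor => sp.
have {sp}/signed_power1_deriv : signed_power 1
   ('X^(pos_part z) * pola p - 'X^(neg_part z) * (polT * polc p)).
  by apply: signed_power_factor; move: sp; congr signed_power; ring.
rewrite /pola /polT !at1E pos_neg_part => e; rewrite -[RHS]e; congr `|_|; ring.
Qed.

Lemma det2_mixed p n : (0 < n)%N -> trivial_eq 0 [:: p] [:: n] -> `|p%:Z - n%:Z| = 1.
Proof.
move=> n0; rewrite /trivial_eq /= !big_seq1 polA_factor (polB_factor n0) !polC_factor => sp.
have {sp}/signed_power1_deriv : signed_power 1
   (pola p * polb n - polT * (polc p * polc n)).
  by do 2 apply: signed_power_factor; move: sp; congr signed_power; ring.
rewrite /pola /polb /polT !at1E => e; rewrite -[RHS]e; congr `|_|; move: e => _.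
case: n n0 => // n _ /=; rewrite !intS; ring.
Qed.

Lemma det2 m n : (0 < m)%N -> (0 < n)%N -> trivial_eq 0 [::] [:: m; n] ->
  `|m%:Z + n%:Z - m%:Z * n%:Z| = 1.
Proof.
move=> m0 n0; rewrite /trivial_eq /= !big_cons !big_nil !polB_factor // !polC_factor => sp.
have {sp}/signed_power1_deriv : signed_power 1
   (polb m * polb n - polT * (polc m * polc n)).
  by do 2 apply: signed_power_factor; move: sp; congr signed_power; ring.
rewrite /polb /polT !at1E => e; rewrite -[RHS]e; congr `|_|; move: e => _.
case: m n m0 n0 => [|m] [|n] // _ _ /=; rewrite !intS; ring.
Qed.

Lemma det3 l m n : (0 < l)%N -> (0 < m)%N -> (0 < n)%N -> trivial_eq 0 [::] [:: l; m; n] ->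
  `|l%:Z * m%:Z + l%:Z * n%:Z + m%:Z * n%:Z - l%:Z * m%:Z * n%:Z| = 1.
Proof.
move=> l0 m0 n0; rewrite /trivial_eq /= !big_cons !big_nil !polB_factor // !polC_factor => sp.
have {sp}/signed_power1_deriv : signed_power 1
   (polb l * (polb m * polb n) - polT * (polc l * (polc m * polc n))).
  by do 3 apply: signed_power_factor; move: sp; congr signed_power; ring.
rewrite /polb /polT !at1E => e; rewrite -[RHS]e; congr `|_|; move: e => _.
case: l m n l0 m0 n0 => [|l] [|m] [|n] // _ _ _ /=; rewrite !intS; ring.
Qed.

(** ** Three or more long columns *)

Lemma odd_dvd_exp2 m j : odd m -> (m %| 2 ^ j)%N -> m = 1%N.
Proof.
move=> om /gcdn_idPl <-; apply/eqP; rewrite -/(coprime m (2 ^ j)).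
by rewrite coprimeXr // coprimen2.
Qed.

Lemma horner_polB (x : int) n : (polB n).[x] = 1 - x ^+ n.-1 * (1 - x + x ^+ 2).
Proof. by rewrite /polB /polT !(hornerD, hornerN, hornerM, hornerXn, hornerX, hornerC). Qed.

Lemma horner_polC (x : int) m : (polC m).[x] = 1 - x ^+ m.
Proof. by rewrite /polC !(hornerD, hornerN, hornerXn, hornerC). Qed.

Lemma horner_polT (x : int) : polT.[x] = 1 - x + x ^+ 2.
Proof. by rewrite /polT !(hornerD, hornerN, hornerXn, hornerX, hornerC). Qed.

Lemma trivial_eq_perm z ps ns ns' : perm_eq ns ns' ->
  trivial_eq z ps ns -> trivial_eq z ps ns'.
Proof.
move=> p; rewrite /trivial_eq (perm_size p).
by rewrite (perm_big _ p) [\prod_(n <- ns) polC n](perm_big _ p).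
Qed.

Lemma polA2 : polA 2 = polB 2.
Proof. rewrite /polA /polB /polT /=; ring. Qed.

(** As polA 2 = polB 2, positive columns 2 can be counted as negative ones.  This is the
    polynomial trace of the merging of 2 and -1 into -2. *)
Lemma trivial_eq_twos z ps ns : all (pred1 2%N) ps ->
  trivial_eq z ps ns -> trivial_eq z [::] (ps ++ ns).
Proof.
move=> p2; rewrite /trivial_eq !big_nil !mul1r !big_cat size_cat /=.
rewrite (_ : \prod_(p <- ps) polA p = \prod_(p <- ps) polB p) //.
by apply: eq_big_seq => p /(allP p2) /eqP->; apply: polA2.
Qed.

Lemma signed_exp2_neq (a : int) s j : a = (-1) ^+ s * 2 ^+ j ->
  forall k m, `|a|%N = (2 ^ k * m)%N -> odd m -> m = 1%N.
Proof.
move=> ea k m ak om; apply: (@odd_dvd_exp2 m j om).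
by move: ak; rewrite ea abszM !abszX /= exp1n mul1n => ->; apply: dvdn_mull.
Qed.

(** The determinant condition only leaves {2, 3, 5} and {2, 3, 7}.  The equation at X = 2 would
    make 8 * 79 or 8 * 313 a power of 2. *)
Lemma no_three_sorted l m n : (1 < l <= m)%N -> (m <= n)%N ->
  ~ trivial_eq 0 [::] [:: l; m; n].
Proof.
case/andP=> l1 lm mn te; have l0 : (0 < l)%N by lia.
have m0 : (0 < m)%N by lia. have n0 : (0 < n)%N by lia.
have d := det3 l0 m0 n0 te.
(* For 3 < l <= m <= n the determinant is at least m n in absolute value. *)
have l3 : (l < 4)%N by nia.
have [l2|l3'] : l = 2%N \/ l = 3%N by lia.
  subst l; have m5 : (m < 5)%N by nia.
  have [m2|[m3|m4]] : m = 2%N \/ m = 3%N \/ m = 4%N by lia.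
  - by subst m; lia.
  - subst m; have [s [j e]] : signed_power 4 _ := te; move: (congr1 (horner^~ 2) e); rewrite horner_signed.
    rewrite /= !big_cons !big_nil !mulr1 !mul1r hornerD hornerN !hornerM.
    rewrite !horner_polB !horner_polC horner_polT.
    have [->|->] : n = 5%N \/ n = 7%N by lia.
      by move=> /signed_exp2_neq /(_ 3 79 erefl isT).
    by move=> /signed_exp2_neq /(_ 3 313 erefl isT).
  - by subst m; lia.
subst l; have [m3|m4] : m = 3%N \/ (3 < m)%N by lia.
  by subst m; lia.
nia.
Qed.

Lemma no_three ns : all (ltn 1) ns -> size ns = 3%N -> ~ trivial_eq 0 [::] ns.
Proof.
move=> ns2 s3 te; have p : perm_eq ns (sort leq ns) by rewrite perm_sym perm_sort.
move: ns2 s3 (sort_sorted leq_total ns) (trivial_eq_perm p te).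
rewrite (perm_all _ p) (perm_size p).
case: (sort leq ns) => [|l [|m [|n [|? ?]]]] //= /andP[l1 _] _ /and3P[lm mn _].
by apply: no_three_sorted; rewrite ?l1.
Qed.

(** At X = -1 the left-hand side is 4^4 and the right-hand side is 2^5 up to sign. *)
Lemma no_four_twos : ~ trivial_eq (-1) [::] [:: 2; 2; 2; 2]%N.
Proof.
move=> te; have [s [j e]] : signed_power 5 _ := te.
move: (congr1 (horner^~ (-1)) e); rewrite horner_signed.
rewrite /= !big_cons !big_nil !mulr1 !mul1r hornerD hornerN !hornerM.
rewrite !horner_polB !horner_polC horner_polT hornerXn -exprD -signr_odd.
by case: (odd _).
Qed.

Lemma trivial_eq_cases e ps ns : all (ltn 1) ps -> all (ltn 1) ns ->
  trivial_eq (1 - e - (size ps)%:Z) ps ns -> trivial_eq (1 + e - (size ns)%:Z) ns ps ->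
  [\/ [/\ ps = [::], ns = [::] & `|e| = 1],
      (size ps + size ns = 1)%N /\
        [\/ e = 0, e = -1 /\ ps = [:: 2%N] | e = 1 /\ ns = [:: 2%N]],
      exists p n, [/\ ps = [:: p], ns = [:: n], e = 0 & `|p%:Z - n%:Z| = 1] |
      [/\ e = -1, ns = [::] & ps = [:: 2; 3]%N \/ ps = [:: 3; 2]%N] \/
      [/\ e = 1, ps = [::] & ns = [:: 2; 3]%N \/ ns = [:: 3; 2]%N]].
Proof.
move=> ps2 ns2 tx ty.
have [x2 x1 xm xge] := second_coefficient ps2 ns2 tx.
have [y2 y1 ym yge] := second_coefficient ns2 ps2 ty.
have twothree m n : (1 < m)%N -> (1 < n)%N -> trivial_eq 0 [::] [:: m; n] ->
    [:: m; n] = [:: 2; 3]%N \/ [:: m; n] = [:: 3; 2]%N.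
  move=> m1 n1 /(det2 (ltnW m1) (ltnW n1)) d.
  have [[-> ->]|[-> ->]] : (m = 2 /\ n = 3 \/ m = 3 /\ n = 2)%N by nia.
    by left.
  by right.
have [N0|[N1|N2]] : (size ps + size ns = 0 \/ size ps + size ns = 1 \/ 1 < size ps + size ns)%N by lia.
- have p0 : ps = [::] by apply: size0nil; lia. have n0 : ns = [::] by apply: size0nil; lia.
  by subst ps ns; constructor 1; split=> //; have := det0 tx => /=; lia.
- constructor 2; split=> //; case: ps ns N1 ps2 ns2 tx ty {x2 x1 xm xge y2 y1 ym yge} => [|p [|? ?]] [|n [|? ?]] //=; try lia.
    move=> _ _ /andP[n2 _] _ /det1 d.
    have [->|[-> ->]] : e = 0 \/ (e = 1 /\ n = 2%N) by nia.
      by constructor 1.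
    by constructor 3.
  move=> _ /andP[p2 _] _ /det1 d _.
  have [->|[-> ->]] : e = 0 \/ (e = -1 /\ p = 2%N) by nia.
    by constructor 1.
  by constructor 2.
have {x2 x1}xE : 1 - e - (size ps)%:Z = 0 \/ 1 - e - (size ps)%:Z = -1.
  by case: x2 => x2; lia.
have {y2 y1}yE : 1 + e - (size ns)%:Z = 0 \/ 1 + e - (size ns)%:Z = -1.
  by case: y2 => y2; lia.
have no3 qs rs : all (ltn 1) qs -> all (ltn 1) rs -> (size qs + size rs)%N = 3%N ->
    all (pred1 2%N) qs -> ~ trivial_eq 0 qs rs.
  move=> q2 r2 s3 qq /(trivial_eq_twos qq); apply: no_three; first by rewrite all_cat q2.
  by rewrite size_cat.
case: xE yE => [x0|xm1] [y0|ym1].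
- rewrite x0 in tx; rewrite y0 in ty.
  case: ps ns ps2 ns2 N2 x0 y0 tx ty {xm xge ym yge no3} => [|p [|p' [|? ?]]] [|n [|n' [|? ?]]] //=; try lia.
  + move=> _ /and3P[n2 n2' _] _ x0 _ tx _; constructor 4; right; split=> //; first by lia.
    exact: twothree.
  + move=> _ /andP[n2 _] _ x0 _ tx _; constructor 3; exists p, n; split=> //; first by lia.
    by apply: det2_mixed tx; lia.
  + move=> /and3P[p2 p2' _] _ _ x0 _ _ ty; constructor 4; left; split=> //; first by lia.
    exact: twothree.
- by case: (no3 ps ns) => //; [lia | exact: ym | rewrite -x0].
- by case: (no3 ns ps) => //; [lia | exact: xm | rewrite -y0].
case: no_four_twos; have := trivial_eq_twos (ym ym1) tx; rewrite xm1.
have /all_pred1P -> : all (pred1 2%N) (ps ++ ns) by rewrite all_cat ym // xm.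
by have -> : size (ps ++ ns) = 4%N by rewrite size_cat; lia.
Qed.

(** * From the bracket to the equations *)

(** Comparing coefficients shows that b - a is a multiple of n. *)
Lemma comp_Xn_cancel (n a b : nat) (f g : {poly int}) : (0 < n)%N -> g`_0 != 0 ->
  'X^a * (f \Po 'X^n) = 'X^b * (g \Po 'X^n) -> exists j, f = 'X^j * g.
Proof.
move=> n0 g0 e; have := congr1 (fun p : {poly int} => p`_b) e.
rewrite !coefXnM ltnn subnn !coef_comp_poly_Xn // dvdn0 div0n.
case: ltnP => [_ g0'|ab]; first by rewrite -g0' eqxx in g0.
case: ifP => [/dvdnP[j bE] _|_ g0']; last by rewrite -g0' eqxx in g0.
exists j; apply/polyP => i.
have := congr1 (fun p : {poly int} => p`_(a + i * n)) e.
rewrite coefXnM ltnNge leq_addr addKn -(subnKC ab) bE exprD -mulrA coefXnM ltnNge leq_addr addKn.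
rewrite !coefXnM !coef_comp_poly_Xn // dvdn_mull // mulnK // ltn_pmul2r //.
by rewrite -mulnBl dvdn_mull // mulnK.
Qed.

Section Evaluation.
Variables (F : fieldType) (x : F).

Definition ev (p : {poly int}) : F := (map_poly intr p).[x].

Lemma ev1 : ev 1 = 1. Proof. by rewrite /ev rmorph1 hornerC. Qed.
Lemma evN p : ev (- p) = - ev p. Proof. by rewrite /ev rmorphN hornerN. Qed.
Lemma evM p r : ev (p * r) = ev p * ev r. Proof. by rewrite /ev rmorphM hornerM. Qed.
Lemma evB p r : ev (p - r) = ev p - ev r. Proof. by rewrite /ev rmorphB hornerD hornerN. Qed.
Lemma evD p r : ev (p + r) = ev p + ev r. Proof. by rewrite /ev rmorphD hornerD. Qed.
Lemma evX : ev 'X = x. Proof. by rewrite /ev map_polyX hornerX. Qed.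
Lemma evXn n : ev 'X^n = x ^+ n. Proof. by rewrite /ev rmorphXn /= map_polyX hornerXn. Qed.
Lemma ev_exp p n : ev (p ^+ n) = ev p ^+ n. Proof. by rewrite /ev rmorphXn horner_exp. Qed.
End Evaluation.

Lemma ev_comp (F : fieldType) (x : F) p r : ev x (p \Po r) = ev (ev x r) p.
Proof. by rewrite /ev map_comp_poly horner_comp. Qed.

Definition evE := (ev_comp, ev1, evN, evM, evB, evD, evX, evXn, ev_exp).

(** The element t of F stands for t^(1/4) or, for the mirror image, for its inverse.  All that
    matters is that it is transcendental, so that identities between values at t are
    identities between polynomials. *)
Section Transfer.
Variables (F : fieldType) (t : F).
Hypotheses (t0 : t != 0) (t1 : t ^+ 4 + 1 != 0).
Hypothesis trans : forall p : {poly int}, ev t p = 0 -> p = 0.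

Definition signed_monomial (z : F) : Prop := exists s M, z = (-1) ^+ s * t ^ M.

Lemma signed_monomialM x y :
  signed_monomial x -> signed_monomial y -> signed_monomial (x * y).
Proof.
move=> [s [M ->]] [s' [M' ->]]; exists (s + s')%N, (M + M').
by rewrite exprD expfzDr //; ring.
Qed.

Lemma signed_monomialV x : signed_monomial x -> signed_monomial x^-1.
Proof.
move=> [s [M ->]]; exists s, (- M).
by rewrite invfM -invr_expz -exprVn invrN invr1.
Qed.

Lemma signed_monomial_neq0 x : signed_monomial x -> x != 0.
Proof. by move=> [s [M ->]]; rewrite mulf_neq0 ?signr_eq0 // expfz_neq0. Qed.

Lemma signed_monomialN1 : signed_monomial (-1).
Proof. by exists 1%N, 0; rewrite expr1 expr0z mulr1. Qed.

(** The variable u = - t of the pretzel formula, t being here the fourth root. *)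
Definition negt : F := - t ^+ 4.
Let q : F := 1 - negt - negt^-1.

Lemma negt_neq0 : negt != 0.
Proof. by rewrite oppr_eq0 expf_neq0. Qed.

Lemma negt_neq1 : 1 - negt != 0.
Proof. by rewrite opprK addrC. Qed.

Lemma signed_monomial_exp x z : signed_monomial x -> signed_monomial (x ^ z).
Proof.
move=> sx; have nx n : signed_monomial (x ^+ n).
  elim: n => [|n IH]; first by exists 0%N, 0; rewrite mulr1.
  by rewrite exprS; apply: signed_monomialM.
by case: z => n; [apply: nx | apply: signed_monomialV; apply: nx].
Qed.

Lemma signed_monomial_negt z : signed_monomial (negt ^ z).
Proof. by apply: signed_monomial_exp; exists 1%N, 4; rewrite expr1 mulN1r. Qed.

Lemma comp_opp_opp (f : {poly int}) : (f \Po - 'X) \Po - 'X = f.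
Proof. by rewrite -comp_polyA raddfN /= comp_polyX opprK comp_polyXr. Qed.

(** An identity in t where f only involves - t^4.  The exponent M must then be a multiple of 4,
    so that the identity is one in the variable - t^4. *)
Lemma ev_signed_power f s M k :
  ev negt f = (-1) ^+ s * t ^ M * (1 - negt) ^+ k -> signed_power k f.
Proof.
move=> e; pose g : {poly int} := (-1) ^+ s * (1 + 'X) ^+ k.
have {}e : 'X^(neg_part M) * ((f \Po (- 'X)) \Po 'X^4) = 'X^(pos_part M) * (g \Po 'X^4).
  apply/eqP; rewrite -subr_eq0; apply/eqP/trans.
  rewrite /g !evE -/negt e /negt opprK.
  apply/eqP; rewrite subr_eq0; apply/eqP; rewrite [1 + t ^+ 4]addrC.
  have tM : t ^+ neg_part M * t ^ M = t ^+ pos_part M.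
    case: M {e} => m /=; first by rewrite mul1r.
    by rewrite -[t ^ _]/(t ^- m.+1) mulfV ?expf_neq0.
  by rewrite -tM; ring.
have g0 : g`_0 != 0.
  rewrite -horner_coef0 /g hornerM !horner_exp hornerD hornerX hornerN !hornerC addr0 expr1n mulr1.
  by rewrite signr_eq0.
have [j ej] := comp_Xn_cancel (isT : 0 < 4)%N g0 e.
exists (s + j)%N, j; rewrite -[f]comp_opp_opp ej /g.
rewrite !(rmorphM, rmorphXn) /= rmorphD rmorph1 rmorphN1 /= comp_polyX (exprNn 'X) exprD.
ring.
Qed.

(** ** Dividing by the columns with one crossing *)

Definition pos_long (c : seq int) : seq nat := [seq `|x|%N | x <- c & 1 < x].
Definition neg_long (c : seq int) : seq nat := [seq `|x|%N | x <- c & x < -1].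
Definition unit_sum (c : seq int) : int := (count_mem 1%R c)%:Z - (count_mem (-1)%R c)%:Z.

(** The monomial m and the powers of u and of 1 - u account for the columns with one crossing
    and for the denominators; both products have the same ones, but for the power of
    u that becomes the exponent of the equation. *)
Lemma clear_units c (k := (count_mem 1%R c + count_mem (-1)%R c)%N) : all (fun x => x != 0) c ->
  exists2 m, signed_monomial m &
    \prod_(x <- c) (negt ^ x - 1) = m * (1 - negt) ^+ k *
      (\prod_(p <- pos_long c) ev negt (polC p) * \prod_(n <- neg_long c) ev negt (polC n)) /\
    \prod_(x <- c) (q + negt ^ x) = m * negt ^ (- unit_sum c - (size (pos_long c))%:Z) * (1 - negt) ^+ k *
      (\prod_(p <- pos_long c) ev negt (polA p) * \prod_(n <- neg_long c) ev negt (polB n)).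
Proof.
rewrite {}/k; have u0 := negt_neq0; have u1 := negt_neq1.
elim: c => [_|x c IH /= /andP[x0 c0]].
  exists 1; first by exists 0%N, 0; rewrite mulr1.
  by rewrite !big_nil !mulr1; split.
have [m sm [eD eE]] := IH c0; rewrite !big_cons eD eE {IH eD eE}.
set D := \prod_(p <- pos_long c) ev negt (polC p); set D' := \prod_(n <- neg_long c) ev negt (polC n).
set E := \prod_(p <- pos_long c) _; set E' := \prod_(n <- neg_long c) ev negt (polB n).
rewrite /unit_sum /=; set a := count_mem 1%R c; set b := count_mem (-1)%R c.
set z := - (a%:Z - b%:Z) - _; set v := negt ^ z.
have [x1|x1] := eqVneq x 1.
  subst x; exists (- m); first by rewrite -mulN1r; apply: signed_monomialM signed_monomialN1 sm.
  rewrite -/(pos_long c) -/(neg_long c) -/D -/D' -/E -/E'.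
  rewrite !(add0n, add1n) exprS.
  have -> : - (a.+1%:Z - b%:Z) - (size (pos_long c))%:Z = z - 1 by rewrite /z; lia.
  rewrite expfzDr // -/v expr1z exprN1; split; first by ring.
  by rewrite /q; field.
have [x2|x2] := eqVneq x (-1).
  subst x; exists (m * negt^-1); first by apply: signed_monomialM sm _; apply: (signed_monomial_negt (-1)).
  rewrite -/(pos_long c) -/(neg_long c) -/D -/D' -/E -/E'.
  rewrite !(add0n, add1n, addnS) exprS.
  have -> : - (a%:Z - b.+1%:Z) - (size (pos_long c))%:Z = z + 1 by rewrite /z; lia.
  by rewrite expfzDr // -/v expr1z exprN1; split; rewrite /q; field.
rewrite !add0n; have [x3|x3] : 1 < x \/ x < -1 by lia.
  have [n xE] : exists n, x = n%:Z by exists `|x|%N; lia.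
  have -> : pos_long (x :: c) = `|x|%N :: pos_long c by rewrite /pos_long /= x3.
  have -> : neg_long (x :: c) = neg_long c.
    by rewrite /neg_long /=; have -> : (x < -1) = false by lia.
  exists (- m); first by rewrite -mulN1r; apply: signed_monomialM signed_monomialN1 sm.
  rewrite !big_cons -/D -/D' -/E -/E' /=.
  have -> : - (a%:Z - b%:Z) - (size (pos_long c)).+1%:Z = z - 1 by rewrite /z; lia.
  rewrite /polA /polC /polT !evE expfzDr // -/v exprN1 xE absz_nat -!exprnP exprS.
  by split; rewrite /q; field.
have [n xE] : exists n, x = - n.+1%:Z by exists `|x|.-1%N; lia.
have -> : pos_long (x :: c) = pos_long c.
  by rewrite /pos_long /=; have -> : (1 < x) = false by lia.
have -> : neg_long (x :: c) = `|x|%N :: neg_long c by rewrite /neg_long /= x3.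
exists (m * negt ^ x); first by apply: signed_monomialM sm _; apply: signed_monomial_negt.
rewrite !big_cons -/D -/D' -/E -/E' -/z -/v.
rewrite xE abszN absz_nat /polB /polC /polT !evE /= -invr_expz -exprnP exprS.
have un : negt ^+ n != 0 by rewrite expf_neq0.
by split; rewrite /q; field; rewrite ?u0 ?un.
Qed.

Lemma size_columns c : all (fun x => x != 0) c ->
  size c = (count_mem 1%R c + count_mem (-1)%R c +
            (size (pos_long c) + size (neg_long c)))%N.
Proof.
rewrite !size_map !size_filter; elim: c => //= x c IH /andP[x0 /IH ->]; lia.
Qed.

Lemma ev_prod (I : Type) (r : seq I) (f : I -> {poly int}) :
  ev negt (\prod_(i <- r) f i) = \prod_(i <- r) ev negt (f i).
Proof. exact: (big_morph _ (evM negt) (ev1 negt)). Qed.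

Lemma exprz_parts z : negt ^+ pos_part z = negt ^ z * negt ^+ neg_part z.
Proof.
case: z => n /=; first by rewrite mulr1.
by rewrite -[negt ^ _]/(negt ^- n.+1) mulVf // expf_neq0 // negt_neq0.
Qed.

Lemma field_trivial_eq c : all (fun x => x != 0) c ->
  (exists2 m, signed_monomial m & \prod_(x <- c) (q + negt ^ x) + q * \prod_(x <- c) (negt ^ x - 1) =
     m * (1 - negt) ^+ (size c).+1) ->
  trivial_eq (1 - unit_sum c - (size (pos_long c))%:Z) (pos_long c) (neg_long c).
Proof.
move=> c0 [m sm]; have u0 := negt_neq0; have u1 := negt_neq1.
have [m' sm' [-> ->]] := clear_units c0.
pose k := (count_mem 1%R c + count_mem (-1)%R c)%N.
pose N := (size (pos_long c) + size (neg_long c)).+1.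
have -> : (size c).+1 = (k + N)%N by rewrite (size_columns c0) addnS.
rewrite (exprD _ k N) -/k; have -> : 1 - unit_sum c - (size (pos_long c))%:Z = 1 + (- unit_sum c - (size (pos_long c))%:Z) by ring.
set z := - unit_sum c - _.
rewrite -!ev_prod -!evM; set P := _ * \prod_(n <- _) polB n; set C := _ * \prod_(n <- _) polC n.
move=> e; rewrite /trivial_eq -/N -/P -/C.
have m0 := signed_monomial_neq0 sm'.
have {e} : negt ^ z * ev negt P + q * ev negt C = m / m' * (1 - negt) ^+ N.
  have u1k : (1 - negt) ^+ k != 0 by rewrite expf_neq0.
  apply: (mulfI (mulf_neq0 m0 u1k)); transitivity (m * ((1 - negt) ^+ k * (1 - negt) ^+ N)).
    by rewrite -e; ring.
  by field.
move=> e.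
have [s [M eM]] : signed_monomial (negt ^+ (neg_part (1 + z)) * negt * (m / m')).
  apply: signed_monomialM; last exact: signed_monomialM sm (signed_monomialV sm').
  by apply: signed_monomialM; [apply: (signed_monomial_negt (Posz _)) | apply: (signed_monomial_negt 1)].
apply: (@ev_signed_power _ s M); rewrite -eM -(mulrA _ (m / m')) -e evB !evM !evXn exprz_parts expfzDr //.
by rewrite /polT !evE expr1z /q; field.
Qed.
End Transfer.

(** ** The pretzel formula in the variable - t *)

Section Bracket.
Variables (F : fieldType) (t : F).
Hypotheses (t0 : t != 0) (t1 : t ^+ 4 + 1 != 0).
Let A := t^-1.
Let d := - A ^+ 2 - A ^- 2.
Let v := negt t.

(** Division by the value of a circle is division by 1 - u, up to a signed monomial. *)
Lemma clear_loops c : exists2 m, signed_monomial t m &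
  \prod_(x <- c) twist_flat A d x * (1 - v) ^+ size c = m * \prod_(x <- c) (v ^ x - 1) /\
  \prod_(x <- c) (d * A ^ x + twist_flat A d x) * (1 - v) ^+ size c =
    m * \prod_(x <- c) (1 - v - v^-1 + v ^ x).
Proof.
have A0 : A != 0 by rewrite invr_eq0.
have v0 : v != 0 by apply: negt_neq0. have v1 : 1 - v != 0 by apply: negt_neq1.
have dE : d = - A ^+ 2 * (1 - v) by rewrite /d /A /v /negt; field; rewrite t0 oner_neq0.
have vA : - A ^ (-3) = v * A.
  by rewrite -[A ^ _]/(A ^- 3) /A exprVn invrK /v /negt mulNr (exprSr t 3) mulfK.
have mA z : signed_monomial t (A ^ z).
  by apply: signed_monomial_exp => //; exists 0%N, (-1); rewrite mul1r.
elim: c => [|x c [m sm [eD eE]]].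
  by exists 1; [exists 0%N, 0; rewrite mulr1 | rewrite !big_nil].
exists (- (A ^+ 2)^-1 * A ^ x * m).
  apply: signed_monomialM => //; apply: signed_monomialM => //.
  rewrite -mulN1r; apply: signed_monomialM (signed_monomialN1 t) (signed_monomialV _) => //.
  exact: (mA 2).
rewrite !big_cons /= exprS; set D := \prod_(i <- c) (_ - 1) in eD *.
set E := \prod_(i <- c) (1 - v - v^-1 + _) in eE *.
set D' := \prod_(i <- c) _ in eD *; set E' := \prod_(i <- c) _ in eE *.
split.
  transitivity (twist_flat A d x * (1 - v) * (D' * (1 - v) ^+ size c)); first by ring.
  rewrite eD /twist_flat vA expfzMl dE; field.
  by rewrite A0 oppr_eq0 expf_neq0 // andbT; exact: v1.
transitivity ((d * A ^ x + twist_flat A d x) * (1 - v) * (E' * (1 - v) ^+ size c)); first by ring.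
(* As v = - A^-4. *)
have A2 : A ^+ 2 = - v^-1 * A ^- 2 by rewrite /A /v /negt; field; rewrite t0 oner_neq0 oppr_eq0 expf_neq0.
rewrite eE /twist_flat vA expfzMl dE {1}A2; field.
by apply/and4P; split; [exact: v0 | exact: A0 | exact: v1 | rewrite oppr_eq0 expf_neq0].
Qed.

(** The bracket of a link with Jones polynomial 1 is a power of - A^3. *)
Lemma trivial_bracket c b w :
  d * b = \prod_(x <- c) (d * A ^ x + twist_flat A d x) +
    (d ^+ 2 - 1) * \prod_(x <- c) twist_flat A d x ->
  b = (- A ^+ 3) ^ w ->
  exists2 m, signed_monomial t m &
    \prod_(x <- c) (1 - v - v^-1 + v ^ x) + (1 - v - v^-1) * \prod_(x <- c) (v ^ x - 1) =
    m * (1 - v) ^+ (size c).+1.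
Proof.
move=> eb ew; have [m sm [eD eE]] := clear_loops c.
have m0 := signed_monomial_neq0 t0 sm.
have A0 : A != 0 by rewrite invr_eq0.
have v0 : v != 0 by apply: negt_neq0. have v1 : 1 - v != 0 by apply: negt_neq1.
have sA : signed_monomial t A by exists 0%N, (-1); rewrite mul1r.
have sA2 : signed_monomial t (A ^+ 2) by rewrite expr2; apply: signed_monomialM.
have s1 := signed_monomialN1 t.
have d2 : d ^+ 2 - 1 = 1 - v - v^-1 by rewrite /d /A /v /negt; field; rewrite t0 ?oner_neq0 ?oppr_eq0 ?expf_neq0.
have dE : d = - A ^+ 2 * (1 - v) by rewrite /d /A /v /negt; field; rewrite t0 oner_neq0.
exists (m^-1 * - A ^+ 2 * b).
  apply: signed_monomialM => //; last first.
    rewrite ew; apply: signed_monomial_exp => //; rewrite -mulN1r.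
    by apply: signed_monomialM => //; rewrite exprS; apply: signed_monomialM.
  by apply: signed_monomialM (signed_monomialV sm) _ => //; rewrite -mulN1r; apply: signed_monomialM.
apply: (mulfI m0); rewrite (exprS (1 - v)) mulrDr mulrCA -eD -eE -d2.
transitivity (d * b * (1 - v) ^+ size c); first by rewrite eb; ring.
by rewrite dE; field.
Qed.
End Bracket.

(** The formula is unchanged when the signs of all columns and of the exponent of t change. *)
Lemma mirror (F : fieldType) (t : F) c : t != 0 -> let v := negt t in
  (exists2 m, signed_monomial t m &
    \prod_(x <- c) (1 - v - v^-1 + v ^ x) + (1 - v - v^-1) * \prod_(x <- c) (v ^ x - 1) =
    m * (1 - v) ^+ (size c).+1) ->
  let c' := map -%R c in let v' := negt t^-1 in
  (exists2 m, signed_monomial t^-1 m &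
    \prod_(x <- c') (1 - v' - v'^-1 + v' ^ x) + (1 - v' - v'^-1) * \prod_(x <- c') (v' ^ x - 1) =
    m * (1 - v') ^+ (size c').+1).
Proof.
move=> t0 v [m sm e] c' v'; have v0 : v != 0 by apply: negt_neq0.
have vE : v' = v^-1 by rewrite /v' /v /negt invrN exprVn.
have st x : signed_monomial t x -> signed_monomial t^-1 x.
  by move=> [s [M ->]]; exists s, (- M); rewrite exprz_inv opprK.
exists (m * (- v) ^+ (size c).+1).
  apply: signed_monomialM; rewrite ?invr_eq0 //; apply: st => //.
  apply: (@signed_monomial_exp _ _ t0 (- v) (Posz _)).
  by exists 0%N, 4; rewrite mul1r /v /negt opprK.
rewrite size_map !big_map vE.
have -> : \prod_(x <- c) (1 - v^-1 - v^-1^-1 + v^-1 ^ (- x)) = \prod_(x <- c) (1 - v - v^-1 + v ^ x).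
  by apply: eq_bigr => x _; rewrite exprz_inv opprK invrK; ring.
have -> : \prod_(x <- c) (v^-1 ^ (- x) - 1) = \prod_(x <- c) (v ^ x - 1).
  by apply: eq_bigr => x _; rewrite exprz_inv opprK.
have -> : 1 - v^-1 - v^-1^-1 = 1 - v - v^-1 by rewrite invrK; ring.
rewrite e -mulrA -exprMn; congr (_ * _ ^+ _); field.
exact: v0.
Qed.

(** ** The generator of the fraction field *)

Lemma ev_tofrac p : ev t4 p = tofrac p.
Proof.
rewrite /ev (@horner_coef_wide _ (size p)) ?size_poly // -[in RHS](coefK p) poly_def rmorph_sum /=.
apply: eq_bigr => i _; rewrite coef_map -mul_polyC rmorphM rmorphXn /=; congr (_ * _).
by rewrite -[in RHS](intz p`_i) !rmorph_int.
Qed.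

Lemma t4_transcendental p : ev t4 p = 0 -> p = 0.
Proof. by rewrite ev_tofrac => /eqP; rewrite tofrac_eq0 => /eqP. Qed.

(** Reversing the coefficients of p turns its value at 1/t into one at t. *)
Lemma transcendentalV (F : fieldType) (t : F) : t != 0 ->
  (forall p, ev t p = 0 -> p = 0) -> forall p, ev t^-1 p = 0 -> p = 0.
Proof.
move=> t0 tr p e; pose n := size p.
(* The reciprocal polynomial of p. *)
pose r : {poly int} := \poly_(i < n) p`_(n.-1 - i).
have evr : ev t r = t ^+ n.-1 * ev t^-1 p.
  rewrite /ev (@horner_coef_wide _ n) ?(leq_trans (size_poly _ _)) ?size_poly //.
  rewrite (@horner_coef_wide _ n) ?size_poly // big_distrr (reindex_inj rev_ord_inj) /=.
  apply: eq_bigr => i _; rewrite !coef_map coef_poly /= rev_ord_proof.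
  have -> : (n.-1 - (n - i.+1))%N = i by have := ltn_ord i; lia.
  have -> : n.-1 = (i + (n - i.+1))%N by have := ltn_ord i; lia.
  by rewrite exprD exprVn; field; rewrite expf_neq0.
have r0 : r = 0 by apply: tr; rewrite evr e mulr0.
apply/polyP => i; rewrite coef0; have [ni|ni] := leqP n i; first by rewrite nth_default.
have := congr1 (fun f : {poly int} => f`_(n.-1 - i)) r0; rewrite coef0 coef_poly.
have -> : (n.-1 - (n.-1 - i))%N = i by lia.
by have -> : (n.-1 - i < n)%N by lia.
Qed.

(** ** The two equations *)

Lemma pos_long_opp c : pos_long (map -%R c) = neg_long c.
Proof.
rewrite /pos_long /neg_long filter_map -map_comp.
rewrite (eq_filter (a2 := fun x => x < -1)); last by move=> x /=; lia.
by apply: eq_map => x /=; rewrite abszN.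
Qed.

Lemma neg_long_opp c : neg_long (map -%R c) = pos_long c.
Proof.
rewrite /pos_long /neg_long filter_map -map_comp.
rewrite (eq_filter (a2 := fun x => 1 < x)); last by move=> x /=; lia.
by apply: eq_map => x /=; rewrite abszN.
Qed.

Lemma unit_sum_opp c : unit_sum (map -%R c) = - unit_sum c.
Proof.
rewrite /unit_sum !count_map opprB; congr (_%:Z - _%:Z); apply: eq_count => x /=; lia.
Qed.

Lemma pow4_add1V (F : fieldType) (t : F) : t != 0 -> t ^+ 4 + 1 != 0 -> t^-1 ^+ 4 + 1 != 0.
Proof.
move=> t0 t1; have -> : t^-1 ^+ 4 + 1 = (t ^+ 4 + 1) / t ^+ 4 by field; rewrite t0 ?oner_neq0.
by rewrite mulf_neq0 // invr_eq0 expf_neq0.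
Qed.

(** The second equation is the first one for the mirror image, with 1/t for t. *)
Lemma trivial_bracket_eqs c w : c != [::] -> all (fun x => x != 0) c ->
  bracket (pretzel c) = (- varA ^+ 3) ^ w ->
  trivial_eq (1 - unit_sum c - (size (pos_long c))%:Z) (pos_long c) (neg_long c) /\
  trivial_eq (1 + unit_sum c - (size (neg_long c))%:Z) (neg_long c) (pos_long c).
Proof.
move=> c0 cn0 ew; have H := trivial_bracket t4_neq0 t4_pow4 (pretzel_bracket c0) ew.
split; first exact: (field_trivial_eq t4_neq0 t4_pow4 t4_transcendental cn0 H).
have cn0' : all (fun x => x != 0) (map -%R c).
  by rewrite all_map; apply: sub_all cn0 => x; rewrite /= oppr_eq0.
have tV0 : t4^-1 != 0 := varA_neq0.
have H' := field_trivial_eq tV0 (pow4_add1V t4_neq0 t4_pow4)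
  (transcendentalV t4_neq0 t4_transcendental) cn0' (mirror t4_neq0 H).
by move: H'; rewrite unit_sum_opp opprK pos_long_opp neg_long_opp.
Qed.

(** * Unknotting the exceptional pretzel links *)

Lemma pos_long_of c : pos_long (long_columns c) = pos_long c.
Proof.
by rewrite /pos_long -filter_predI; congr map; apply: eq_filter => x /=; lia.
Qed.

Lemma neg_long_of c : neg_long (long_columns c) = neg_long c.
Proof.
by rewrite /neg_long -filter_predI; congr map; apply: eq_filter => x /=; lia.
Qed.

Lemma size_long_columns c :
  size (long_columns c) = (size (pos_long c) + size (neg_long c))%N.
Proof.
by rewrite !size_map !size_filter; elim: c => //= x c ->; lia.
Qed.

Lemma long_signs (x : int) : (1 < `|x|)%N ->
  (1 < x) = true /\ (x < -1) = false /\ x = `|x|%N%:Z \/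
  (1 < x) = false /\ (x < -1) = true /\ x = - `|x|%N%:Z.
Proof. by move=> x1; lia. Qed.

(** Each solution found in trivial_eq_cases is a link that the moves of the first part undo. *)
Lemma unknotted_trivial_eq c (e := unit_sum c) (ps := pos_long c) (ns := neg_long c) :
  c != [::] -> all (fun x => x != 0) c ->
  trivial_eq (1 - e - (size ps)%:Z) ps ns -> trivial_eq (1 + e - (size ns)%:Z) ns ps ->
  unknotted (pretzel c).
Proof.
move=> c0 cn0 tx ty.
have ps2 : all (ltn 1) ps by rewrite all_map; apply/allP => x; rewrite mem_filter => /andP[x1 _] /=; lia.
have ns2 : all (ltn 1) ns by rewrite all_map; apply/allP => x; rewrite mem_filter => /andP[x1 _] /=; lia.
have cases := trivial_eq_cases ps2 ns2 tx ty.
have so := size_long_columns c; rewrite -/ps -/ns in so.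
have o1 : all (fun x : int => 1 < `|x|)%N (long_columns c) by apply: filter_all.
have nf a b : e = a%:Z - b%:Z -> a = 0%N \/ b = 0%N -> (0 < a + b + size (long_columns c))%N ->
    unknotted (pretzel (nseq a 1 ++ nseq b (-1) ++ long_columns c)) -> unknotted (pretzel c).
  move=> eab ab s0; apply: unknotted_same => //; apply: pretzel_normal_form => //.
  have H m n : m%:Z - n%:Z = a%:Z - b%:Z -> (m + b = n + a)%N by lia.
  exact: H eab.
have psE : ps = pos_long (long_columns c) by rewrite pos_long_of.
have nsE : ns = neg_long (long_columns c) by rewrite neg_long_of.
clear tx ty ps2 ns2; clearbody e ps ns; move: (long_columns c) so o1 nf psE nsE => o so o1 nf psE nsE.
case: cases => [[p0 n0 e1]|[s1 e1]|[p [n [pE nE e0 pn]]]|].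
- have o0 : o = [::] by apply: size0nil; rewrite so p0 n0.
  have [ee|ee] : e = 1 \/ e = -1 by lia.
    by apply: (nf 1%N 0%N); rewrite ?o0 ?ee //=; [right | apply: unknotted_one].
  by apply: (nf 0%N 1%N); rewrite ?o0 ?ee //=; [left | apply: unknotted_one].
- case: o so o1 nf psE nsE => [|x [|? ?]] so o1 nf psE nsE; rewrite s1 // in so.
  have [e0|[e0 pE]|[e0 nE]] := e1.
  + by apply: (nf 0%N 0%N) => //; [left | apply: unknotted_one].
  + apply: (nf 0%N 1%N) => //; first by left.
    apply: unknotted_two; move: o1; rewrite /= andbT => /long_signs.
    by move: psE; rewrite pE /pos_long /= => psE [[x1 [_ xE]]|[x1 _]]; move: psE; rewrite x1 //= xE => -[<-].
  + apply: (nf 1%N 0%N) => //; first by right.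
    apply: unknotted_two; move: o1; rewrite /= andbT => /long_signs.
    by move: nsE; rewrite nE /neg_long /= => nsE [[_ [x1 _]]|[_ [x1 xE]]]; move: nsE; rewrite x1 //= xE abszN => -[<-].
- case: o so o1 nf psE nsE => [|x [|y [|? ?]]] so o1 nf; rewrite pE nE /= in so *; try lia.
  case/and3P: o1 => x1 y1 _; rewrite /pos_long /neg_long /= => psE nsE.
  apply: (nf 0%N 0%N) => //; first by left.
  apply: unknotted_two; move: psE nsE.
  case: (long_signs x1) (long_signs y1) => [[-> [-> xE]]|[-> [-> xE]]] [[-> [-> yE]]|[-> [-> yE]]] //=.
    by move=> [pE'] [nE']; rewrite xE yE; lia.
  by move=> [pE'] [nE']; rewrite xE yE; lia.
move=> [[e1 n0 pE]|[e1 p0 nE]].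
- have s2 : size ps = 2%N by case: pE => ->.
  case: o so o1 nf psE nsE => [|x [|y [|? ?]]] so o1 nf; rewrite n0 s2 // in so *.
  case/and3P: o1 => x1 y1 _; rewrite /pos_long /neg_long /= => psE nsE.
  apply: (nf 0%N 1%N) => //; first by left.
  apply: (@unknotted_absorb true); move: pE psE nsE.
  case: (long_signs x1) (long_signs y1) => [[-> [-> xE]]|[-> [-> xE]]] [[-> [-> yE]]|[-> [-> yE]]] //=.
  by rewrite xE yE !absz_nat => -[] -> [<- <-] _; [left|right].
have s2 : size ns = 2%N by case: nE => ->.
case: o so o1 nf psE nsE => [|x [|y [|? ?]]] so o1 nf; rewrite p0 s2 // in so *.
case/and3P: o1 => x1 y1 _; rewrite /pos_long /neg_long /= => psE nsE.
apply: (nf 1%N 0%N) => //; first by right.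
apply: (@unknotted_absorb false); move: nE psE nsE.
case: (long_signs x1) (long_signs y1) => [[-> [-> xE]]|[-> [-> xE]]] [[-> [-> yE]]|[-> [-> yE]]] //=.
by rewrite xE yE !abszN !absz_nat => -[] -> _ [<- <-]; [left|right].
Qed.

Lemma exprz_unique (F : fieldType) (a b : F) n : a != 0 -> a ^ (- n) * b = 1 -> b = a ^ n.
Proof.
by move=> a0 e; rewrite -[LHS]mul1r -(mulfV (_ : a ^ n != 0)) ?expfz_neq0 // invr_expz -mulrA e mulr1.
Qed.

Theorem theorem4p20 (n : nat) (c : n.-tuple int) (o : seq bool)
    (n_gt0 : (0 < n)%N)
    (c_neq0 : forall i : 'I_n, tnth c i != 0)
    (knot : is_knot (pretzel c))
    (nontrivial : ~ unknotted (pretzel c))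
    (oriented : orientation (pretzel c) o) :
  jones (pretzel c) o <> 1.
Proof.
move=> jones1; apply: nontrivial.
have c0 : tval c != [::] by rewrite -size_eq0 size_tuple -lt0n.
have cn0 : all (fun x => x != 0) c.
  by apply/allP => x /tnthP[i ->]; apply: c_neq0.
have X0 : - varA ^+ 3 != 0 by rewrite oppr_eq0; apply: expf_neq0 varA_neq0.
have ew := exprz_unique X0 jones1.
have [tx ty] := trivial_bracket_eqs c0 cn0 ew.
exact: unknotted_trivial_eq tx ty.
Qed.
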